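(* Let $u$ be a weak solution of the nonlocal model $$\frac{\partial u}{\partial t}+\int_0^\delta \frac{g(u,\tau_h u)-g(\tau_{-h}u,u)}{h}\,\omega_\delta(h)\,dh=0\quad\text{in }\mathbb{R}\times(0,T),\qquad u(x,0)=u_0(x),$$ which is piecewise $C^1$ with an isolated discontinuity that moves along a rectifiable curve $\Gamma=\{(x(t),t): t\in I\}$ for some interval $I\subset[0,\infty)$. Then $x'\equiv 0$; in other words, the discontinuity is stationary ($x(t)$ is constant on $I$).
   Context: Fix $T>0$, $\delta>0$ and $u_0\in L^\infty(\mathbb{R})$; the interval $I$ is contained in the time interval of existence $[0,T)$. Notation: $\tau_{\pm h}u(x,t)=u(x\pm h,t)$. Kernel: $\omega_\delta:\mathbb{R}\to\mathbb{R}$ is integrable with $\omega_\delta\ge 0$, $\operatorname{supp}\omega_\delta\subseteq[0,\delta]$ and $\int_0^\delta\omega_\delta(h)\,dh=1$. Flux: $g:\mathbb{R}\times\mathbb{R}\to\mathbb{R}$ is consistent with a flux $f$, i.e. $g(u,u)=f(u)$; monotone, i.e. $\partial_1 g\ge 0$ and $\partial_2 g\le 0$ (nondecreasing in the first and nonincreasing in the second argument); and Lipschitz continuous, i.e. $|g(u_1,v_1)-g(u_2,v_2)|\le C(|u_1-u_2|+|v_1-v_2|)$ for all real $u_1,u_2,v_1,v_2$. Weak solution: $u\in L^\infty(\mathbb{R}\times(0,T))$ such that for all $\phi\in C_c^\infty(\mathbb{R}\times[0,T))$ $$\int_0^T\!\!\int_{\mathbb{R}}u\,\frac{\partial\phi}{\partial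 t}\,dx\,dt+\int_{\mathbb{R}}u_0(x)\phi(x,0)\,dx+\int_0^T\!\!\int_{\mathbb{R}}\int_0^\delta\frac{\tau_h\phi-\phi}{h}\,g(u,\tau_hu)\,\omega_\delta(h)\,dh\,dx\,dt=0.$$ ''Piecewise $C^1$ with an isolated discontinuity along $\Gamma$'' means: $x:I\to\mathbb{R}$ is continuous, and every point $(x(t_0),t_0)\in\Gamma$ with $t_0$ in the interior of $I$ has an open neighbourhood $D\subset\mathbb{R}\times(0,T)$ such that $u$ is $C^1$ on each of $\{(x,t)\in D:x<x(t)\}$ and $\{(x,t)\in D:x>x(t)\}$, up to the part of $\Gamma$ in $D$, and the one-sided limits $u_\pm(t)=\lim_{x\to x(t)\pm0}u(x,t)$ satisfy $u_-(t)\ne u_+(t)$. *)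

(* Defs.v *)
From HB Require Import structures.
From mathcomp Require Import all_boot all_order all_algebra.
From mathcomp Require Import all_classical all_reals all_analysis.

Set Implicit Arguments.
Unset Strict Implicit.
Unset Printing Implicit Defensive.

Import Order.TTheory GRing.Theory Num.Theory.
Import numFieldNormedType.Exports.

Local Open Scope classical_set_scope.
Local Open Scope ring_scope.

(* Points of the space-time plane are pairs p = (x, t): p.1 is the position and
   p.2 the time. *)

Section NonlocalModel.
Context {R : realType}.

Local Notation leb := (@lebesgue_measure R).

Definition dx (v : R * R -> R) : R * R -> R := 'D_(1, 0) v.
Definition dt (v : R * R -> R) : R * R -> R := 'D_(0, 1) v.

Record nonlocal_kernel (delta : R) (omega : R -> R) : Prop := {
  kernel_integrable : leb.-integrable setT (EFin \o omega);
  kernel_ge0 : forall h, 0 <= omega h;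
  kernel_supp : closure [set h | omega h != 0] `<=` `[0, delta];
  kernel_mass : \int[leb]_(h in `[0, delta]) omega h = 1 }.

Record numerical_flux (f : R -> R) (g : R -> R -> R) : Prop := {
  flux_consistent : forall u, g u u = f u;
  flux_monotone1 : forall v, {homo (fun u => g u v) : a b / a <= b};
  flux_monotone2 : forall u, {homo (fun v => g u v) : a b / a <= b >-> b <= a};
  flux_lipschitz : exists C : R, forall u1 v1 u2 v2,
    `|g u1 v1 - g u2 v2| <= C * (`|u1 - u2| + `|v1 - v2|) }.

Fixpoint Ck (k : nat) (v : R * R -> R) : Prop :=
  match k with
  | 0%N => continuous v
  | k'.+1 => [/\ forall p, differentiable v p, Ck k' (dx v) & Ck k' (dt v)]
  end.

(* C_c^oo(R x [0, T)): its elements are the restrictions to t >= 0 of the smooth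
   functions on the plane whose support is compact and lies in R x (-oo, T).
   Only the values at times t >= 0 enter the weak formulation. *)
Definition test_function (T : R) (phi : R * R -> R) : Prop :=
  [/\ forall k, Ck k phi,
      compact (closure [set p | phi p != 0]) &
      closure [set p | phi p != 0] `<=` [set p | p.2 < T]].

(* u is only relevant on R x (0, T); its values elsewhere are arbitrary. *)
Definition weak_solution (T delta : R) (omega : R -> R) (g : R -> R -> R)
    (u0 : R -> R) (u : R * R -> R) : Prop :=
  (u \_ (setT `*` `]0, T[)) \in Lfun (leb \x leb)%E +oo%E /\
  forall phi, test_function T phi ->
    \int[leb]_(t in `]0, T[) \int[leb]_(x in setT) (u (x, t) * dt phi (x, t))
  + \int[leb]_(x in setT) (u0 x * phi (x, 0))
  + \int[leb]_(t in `]0, T[) \int[leb]_(x in setT) \int[leb]_(h in `[0, delta])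
      ((phi (x + h, t) - phi (x, t)) / h * g (u (x, t)) (u (x + h, t)) * omega h)
  = 0.

Definition rectifiable (I : set R) (c : R -> R * R) : Prop :=
  exists L : R, forall (n : nat) (s : nat -> R),
    (forall i, (i <= n)%N -> I (s i)) ->
    (forall i, (i < n)%N -> s i <= s i.+1) ->
    \sum_(i < n) Num.sqrt (((c (s i.+1)).1 - (c (s i)).1) ^+ 2
                         + ((c (s i.+1)).2 - (c (s i)).2) ^+ 2) <= L.

(* For A open: v is C^1 on A, and v and its first derivatives extend
   continuously from A to A `|` G. *)
Definition C1_up_to (A G : set (R * R)) (v : R * R -> R) : Prop :=
  [/\ forall p, A p -> differentiable v p,
      {within A, continuous (dx v)},
      {within A, continuous (dt v)} &
      forall p, G p -> [/\ cvg (v q @[q --> within A (nbhs p)]),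
                          cvg (dx v q @[q --> within A (nbhs p)]) &
                          cvg (dt v q @[q --> within A (nbhs p)])]].

(* The curve x is only meaningful on I, so the neighbourhood D of a point of
   the graph is taken inside R x I. *)
Definition piecewise_C1_with_jump (T : R) (I : set R) (x : R -> R)
    (u : R * R -> R) : Prop :=
  {within I, continuous x} /\
  forall t0, I° t0 ->
    (exists D : set (R * R),
      [/\ open D, D (x t0, t0), D `<=` setT `*` (`]0, T[ `&` I),
          C1_up_to (D `&` [set p | p.1 < x p.2]) (D `&` [set p | p.1 = x p.2]) u &
          C1_up_to (D `&` [set p | x p.2 < p.1]) (D `&` [set p | p.1 = x p.2]) u])
    /\ (exists um up : R,
         [/\ u (y, t0) @[y --> (x t0)^'-] --> um,
             u (y, t0) @[y --> (x t0)^'+] --> up & um != up]).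

End NonlocalModel.

(* Main.v *)
Require Import Defs.
From HB Require Import structures.
From mathcomp Require Import all_boot all_order all_algebra.
From mathcomp Require Import all_classical all_reals all_analysis.
From mathcomp Require Import measurable_realfun ess_sup_inf.
From mathcomp Require Import ring lra.

Import Order.TTheory GRing.Theory Num.Theory.
Import numFieldNormedType.Exports.

Local Open Scope classical_set_scope.
Local Open Scope ring_scope.

(** Why the discontinuity cannot move.  For a local conservation law the flux
    difference across the jump is a Dirac mass, which can balance the Dirac mass
    that u_t carries along a moving jump.  Here the flux difference is averaged
    against omega(h)/h, and the average is an integrable function: u is Lipschitz
    in x on each side of the curve and bounded across it, so the translate of u by
    h differs from u by O(h) off a set of x of measure h, and by O(1) on it.  The
    x-integral of |u(x+h) - u(x)| is thus O(h), which cancels the factor 1/h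
    (flux_difference_near), and omega has integral 1.  Hence u_t has no singular
    part, and a moving jump would create one.

    This is made quantitative with a single test function alpha(x) beta(t), so that
    no distribution theory is involved.  Suppose x(s) and x(t) differ by d.  Take
    alpha to be a smooth plateau strictly between x(s) and x(t), of mass m
    comparable to d, and beta a smooth approximation of the indicator of [s, t].
    At time s the support of alpha lies on one side of the jump and at time t on
    the other, so the term with the time derivative of the test function is close
    to (u_+ - u_-) m up to sign (window_estimate).  The nonlocal term is at most
      (t - s) (K * int_[0, eta] omega + B m / eta)
    for every small eta: translations h <= eta are controlled by the previous
    paragraph, larger ones trivially (nonlocal_term_le).  Therefore, for all windows
    [s, t] near t0 at whose ends x differs (jump_window),
      |u_+ - u_-| m / 2 <= (t - s) (K * int_[0, eta] omega + B m / eta).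

    If x were not constant near t0, bisecting an interval on which it changes gives
    windows with t - s arbitrarily small and (t - s) / d, hence (t - s) / m, bounded
    (bisection).  Choosing first eta, so that the mass of omega on [0, eta] is small,
    and then a short window contradicts the inequality (locally_constant).  So x is
    locally constant in the interior of I, and constant on I by continuity. *)

(** * Smooth functions and products of smooth functions *)

Section SmoothFunctions.
Context {R : realType}.
Implicit Types f g : R -> R.

(** Smoothness in one variable is encoded by the existence of successive
    derivatives, which keeps the inductions for products and composites free of
    the derivation operator. *)
Fixpoint nderivable (n : nat) f : Prop :=
  match n with
  | 0%N => True
  | n'.+1 => exists2 f', (forall x : R, is_derive x 1 f (f' x)) & nderivable n' f'
  end.

Definition smooth f := forall n, nderivable n f.

Lemma nderivableS n f : nderivable n.+1 f -> nderivable n f.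
Proof. by elim: n f => // n ih f [f' ff' /ih f'n]; exists f'. Qed.

Lemma nderivable_cst n (c : R) : nderivable n (fun=> c).
Proof.
elim: n c => // n ih c; exists (fun=> 0) => // x.
exact: (@is_derive_cst R R R c x 1).
Qed.

Lemma nderivableD n f g :
  nderivable n f -> nderivable n g -> nderivable n (fun x => f x + g x).
Proof.
elim: n f g => // n ih f g [f' ff' f'n] [g' gg' g'n].
exists (fun x => f' x + g' x); last exact: ih.
by move=> x; have := ff' x; have := gg' x => ? ?; exact: is_deriveD.
Qed.

Lemma nderivableM n f g :
  nderivable n f -> nderivable n g -> nderivable n (fun x => f x * g x).
Proof.
elim: n f g => // n ih f g fn gn.
have [f' ff' f'n] := fn; have [g' gg' g'n] := gn.
exists (fun x => f x * g' x + g x * f' x).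
  by move=> x; have := ff' x; have := gg' x => ? ?; exact: is_deriveM.
by apply: nderivableD; apply: ih => //; exact: nderivableS.
Qed.

Lemma nderivable_comp n f g :
  nderivable n f -> nderivable n g -> nderivable n (fun x => f (g x)).
Proof.
elim: n f g => // n ih f g fn gn.
have [f' ff' f'n] := fn; have [g' gg' g'n] := gn.
exists (fun x => f' (g x) * g' x); first by move=> x; exact: is_derive1_comp.
by apply: nderivableM => //; apply: ih => //; exact: nderivableS.
Qed.

Lemma smooth_cst (c : R) : smooth (fun=> c).
Proof. by move=> n; exact: nderivable_cst. Qed.

Lemma is_derive_affine (a b x : R) : is_derive x 1 (fun y => a * y + b) a.
Proof. by apply: is_derive_eq; rewrite addr0 [_%:A]mulr1. Qed.

Lemma smooth_affine (a b : R) : smooth (fun x => a * x + b).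
Proof.
case=> // n; exists (fun=> a); last exact: nderivable_cst.
by move=> x; exact: is_derive_affine.
Qed.

Lemma smoothD f g : smooth f -> smooth g -> smooth (fun x => f x + g x).
Proof. by move=> fs gs n; exact: nderivableD. Qed.

Lemma smoothM f g : smooth f -> smooth g -> smooth (fun x => f x * g x).
Proof. by move=> fs gs n; exact: nderivableM. Qed.

Lemma smooth_comp f g : smooth f -> smooth g -> smooth (fun x => f (g x)).
Proof. by move=> fs gs n; exact: nderivable_comp. Qed.

Lemma smooth_continuous f : smooth f -> continuous f.
Proof.
move=> /(_ 1%N) [f' ff' _] x; apply/differentiable_continuous/derivable1_diffP.
by have := ff' x.
Qed.

End SmoothFunctions.

Section Tensor.
Context {R : realType}.

Definition tensor (a b : R -> R) (p : R * R) : R := a p.1 * b p.2.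

Lemma is_diff_fst (p : R * R) : is_diff p (fst : R * R -> R) (fst : R * R -> R).
Proof.
have c : continuous (fst : R * R -> R) by move=> ?; exact: cvg_fst.
by apply: DiffDef; [exact: linear_differentiable|exact: diff_lin].
Qed.

Lemma is_diff_snd (p : R * R) : is_diff p (snd : R * R -> R) (snd : R * R -> R).
Proof.
have c : continuous (snd : R * R -> R) by move=> ?; exact: cvg_snd.
by apply: DiffDef; [exact: linear_differentiable|exact: diff_lin].
Qed.

Lemma tensor_is_diff (a b : R -> R) (a' b' : R) (p : R * R) :
  is_derive p.1 1 a a' -> is_derive p.2 1 b b' ->
  [/\ differentiable (tensor a b) p, dx (tensor a b) p = a' * b p.2 &
      dt (tensor a b) p = a p.1 * b'].
Proof.
move=> da db.
have ha : differentiable a p.1 by apply/derivable1_diffP.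
have hb : differentiable b p.2 by apply/derivable1_diffP.
have h1 : is_diff p (a \o (fst : R * R -> R)) ('d a (p.1) \o (fst : R * R -> R)).
  by apply: is_diff_comp; [exact: is_diff_fst|exact: differentiableP].
have h2 : is_diff p (b \o (snd : R * R -> R)) ('d b (p.2) \o (snd : R * R -> R)).
  by apply: is_diff_comp; [exact: is_diff_snd|exact: differentiableP].
have h := @is_diffM _ _ _ _ _ _ _ h1 h2.
have hd : differentiable (tensor a b) p by exact: ex_diff.
have da' : a^`()%classic p.1 = a' by rewrite derive1E derive_val.
have db' : b^`()%classic p.2 = b' by rewrite derive1E derive_val.
have dbE (k : R) : 'd b (p.2) k = k * b'.
  by have /(congr1 (fun F => F k)) := diff1E hb; rewrite db'.
have daE (k : R) : 'd a (p.1) k = k * a'.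
  by have /(congr1 (fun F => F k)) := diff1E ha; rewrite da'.
have hE v : 'D_v (tensor a b) p = a p.1 * (v.2 * b') + b p.2 * (v.1 * a').
  rewrite deriveE // (_ : tensor a b = (a \o (fst : R * R -> R)) * (b \o (snd : R * R -> R))) // diff_val /=.
  transitivity (a p.1 * 'd b (p.2) v.2 + b p.2 * 'd a (p.1) v.1); first by [].
  by congr (_ * _ + _ * _); [exact: dbE|exact: daE].
by split=> //; rewrite /dx /dt hE /= !mul0r !mul1r !mulr0 ?addr0 ?add0r // mulrC.
Qed.

(** Both partial derivatives of a product alpha(x) beta(t) are again products,
    which is what makes the induction on k close. *)
Lemma tensor_Ck k a b : nderivable k.+1 a -> nderivable k.+1 b ->
  Ck k (tensor a b).
Proof.
elim: k a b => [|k ih] a b [a' da a'k] [b' db b'k].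
  move=> p; apply: differentiable_continuous.
  by have [] := tensor_is_diff _ _ _ _ p (da _) (db _).
have dE p := tensor_is_diff _ _ _ _ p (da p.1) (db p.2).
split=> [p||]; first by have [] := dE p.
- rewrite (_ : dx _ = tensor a' b).
    by apply: ih => //; apply: nderivableS; exists b'.
  by apply/funext => p; have [] := dE p.
- rewrite (_ : dt _ = tensor a b').
    by apply: ih => //; apply: nderivableS; exists a'.
  by apply/funext => p; have [] := dE p.
Qed.

Lemma tensor_dt (a b b' : R -> R) : smooth a ->
  (forall x : R, is_derive x 1 b (b' x)) -> dt (tensor a b) = tensor a b'.
Proof.
move=> /(_ 1%N)[a' da _] db; apply/funext => p.
by have [] := tensor_is_diff _ _ _ _ p (da _) (db _).
Qed.

(** Products of smooth compactly supported functions are the only test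
    functions that the proof uses. *)
Lemma tensor_test_function (T : R) a b (a0 a1 b0 b1 : R) :
  smooth a -> smooth b ->
  (forall x, x \notin `[a0, a1] -> a x = 0) ->
  (forall t, t \notin `[b0, b1] -> b t = 0) ->
  b1 < T -> test_function T (tensor a b).
Proof.
move=> sa sb a_out b_out b1T.
have sub : closure [set p | tensor a b p != 0] `<=` `[a0, a1] `*` `[b0, b1].
  rewrite closureE; apply: smallest_sub.
    have -> : `[a0, a1] `*` `[b0, b1] =
        fst @^-1` `[a0, a1] `&` snd @^-1` `[b0, b1] :> set (R * R) by [].
    by apply: closedI; apply: closed_comp => [? _|]; try exact: interval_closed;
      [exact: cvg_fst|exact: cvg_snd].
  move=> p /=; rewrite /tensor mulf_eq0 negb_or => /andP[pa pb]; split => /=.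
    by apply: contraNT pa => /a_out ->.
  by apply: contraNT pb => /b_out ->.
split.
- by move=> k; apply: tensor_Ck.
- apply: (subclosed_compact _ _ sub); first exact: closed_closure.
  by apply: compact_setX; exact: segment_compact.
- by move=> p /sub[_ /=]; rewrite in_itv /= => /andP[_ /le_lt_trans]; exact.
Qed.

End Tensor.

(** * Smooth steps and plateaus *)

Section Plateau.
Context {R : realType}.

(** For n = 0 this is the classical function exp(-1/x), flat at 0; the powers
    of 1/x form a family that is stable under derivation. *)
Definition flat (n : nat) (x : R) : R :=
  if 0 < x then x^-1 ^+ n * expR (- x^-1) else 0.

Lemma flat_le0 n x : x <= 0 -> flat n x = 0.
Proof. by move=> x0; rewrite /flat ltNge x0. Qed.

Lemma flat_gt0 n x : 0 < x -> 0 < flat n x.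
Proof. by move=> x0; rewrite /flat x0 mulr_gt0 ?expR_gt0 ?exprn_gt0 ?invr_gt0. Qed.

Lemma flat_ge0 n x : 0 <= flat n x.
Proof. by have [/flat_le0 ->|/(flat_gt0 n)/ltW] := leP x 0. Qed.

Lemma flat_bounded n x : flat n x <= n`!%:R.
Proof.
have [/flat_le0 -> //|x0] := leP x 0; rewrite /flat x0 expRN ler_pdivrMr ?expR_gt0//.
have y0 : 0 <= x^-1 by rewrite invr_ge0 ltW.
case: n => [|n]; first by rewrite expr0 fact0 mul1r ltW // expR_gt1 invr_gt0.
rewrite mulrC -ler_pdivrMr ?ltr0n ?fact_gt0//.
by apply: le_trans (expR_ge1Dxn n y0); rewrite lerDr.
Qed.

(** Dividing by x stays in the family; at x = 0 this exhibits the difference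
    quotient of flat n as flat n.+1. *)
Lemma flatS n x : flat n x = flat n.+1 x * x.
Proof.
have [x0|x0] := leP x 0; first by rewrite !flat_le0 ?mul0r.
by rewrite /flat x0 exprSr -!mulrA [_ * x]mulrC mulKf // gt_eqF.
Qed.

Lemma is_derive_flat n (x : R) : is_derive x 1 (flat n) (flat n.+2 x - n%:R * flat n.+1 x).
Proof.
have [x0|x0|->] := ltgtP x 0.
- rewrite !flat_le0 ?(ltW x0) // mulr0 subr0.
  apply: (@near_eq_is_derive _ _ _ (cst 0)).
  by near=> y; rewrite flat_le0 // ltW //; near: y; exact: lt_nbhsl.
- have xN0 : x != 0 by rewrite gt_eqF.
  have dV : is_derive x 1 (fun y : R => y^-1) (- x ^- 2 *: 1).
    exact: (@is_deriveV _ id).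
  have dE := @is_derive1_comp R expR (fun y => - y^-1) x _ _ (is_derive_expR _) (is_deriveN dV).
  have dX := @is_deriveM _ _ _ _ x _ _ _ (@is_deriveX _ _ (fun y : R => y^-1) n x 1 _ dV) dE.
  apply: (@near_eq_is_derive _ _ _ ((fun y => y^-1) ^+ n * (expR \o (fun y => - y^-1)))).
    near=> y; rewrite /flat ifT; first by rewrite fctE exprfctE.
    by near: y; exact: lt_nbhsr.
  apply: is_derive_eq.
  rewrite exprfctE /= /GRing.scale /= /flat x0.
  case: n {dX} => [|n]; first by rewrite !expr0; field.
  rewrite !exprS /= expr0 -natr1; set z := x^-1 ^+ n.
  by field.
- rewrite !flat_le0 // mulr0 subr0; apply/is_derive1_caratheodory.
  exists (flat n.+1); split; last by rewrite flat_le0.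
    by move=> z; rewrite subr0 [flat n 0]flat_le0 // subr0 -flatS.
  rewrite /prop_for /continuous_at flat_le0 //.
  apply/cvgrPdist_le => /= e e0.
  (* flat n.+1 z = flat n.+2 z * z, and flat n.+2 is bounded. *)
  near=> z; rewrite sub0r normrN flatS normrM ger0_norm ?flat_ge0//.
  have C0 : 0 < (n.+2`!%:R : R) by rewrite ltr0n fact_gt0.
  apply: le_trans (_ : n.+2`!%:R * `|z| <= _).
    by rewrite ler_wpM2r ?flat_bounded.
  rewrite mulrC -ler_pdivlMr //; near: z.
  have e1 : 0 < e / n.+2`!%:R by rewrite divr_gt0.
  by apply/nbhs_ballP; exists (e / n.+2`!%:R) => //= z; rewrite /ball /= sub0r normrN => /ltW.
Unshelve. all: by end_near. Qed.

(** Each derivative is a linear combination of two members of the family, so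
    induction applies to all exponents at once. *)
Lemma smooth_flat n : smooth (flat n).
Proof.
move=> k; elim: k n => // k ih n.
exists (fun x => flat n.+2 x + (- n%:R) * flat n.+1 x).
  by move=> x; rewrite mulNr; exact: is_derive_flat.
apply: nderivableD => //; apply: nderivableM => //; exact: nderivable_cst.
Qed.

Lemma is_derive_flat0 (x : R) : is_derive x 1 (flat 0) (flat 2 x).
Proof. by have := is_derive_flat 0 x; rewrite mul0r subr0. Qed.

Lemma flat0_homo : {homo flat 0 : x y / x <= y}.
Proof.
move=> x y xy; have [x0|x0] := leP x 0; first by rewrite flat_le0 // flat_ge0.
have y0 := lt_le_trans x0 xy.
by rewrite /flat x0 y0 !expr0 !mul1r ler_expR lerN2 lef_pV2.
Qed.

(** Composing the flat function with an affine image of itself gives a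
    nondecreasing transition from 0 to 1 whose smoothness only needs composition,
    with no division by a non-constant function. *)
Definition step (x : R) : R := flat 0 (flat 0 1 - flat 0 (1 - x)) / flat 0 (flat 0 1).

Definition step' (x : R) : R :=
  flat 2 (flat 0 1 - flat 0 (1 - x)) * flat 2 (1 - x) / flat 0 (flat 0 1).

Lemma step_scale_gt0 : 0 < flat 0 (flat 0 1). Proof. by do 2 apply: flat_gt0. Qed.

Lemma step_le0 x : x <= 0 -> step x = 0.
Proof.
by move=> x0; rewrite /step flat_le0 ?mul0r // subr_le0 flat0_homo// lerBrDr gerDl.
Qed.

Lemma step_ge1 x : 1 <= x -> step x = 1.
Proof.
move=> x1; rewrite /step [X in _ - X]flat_le0 ?subr_le0 // subr0.
by rewrite divff // gt_eqF // step_scale_gt0.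
Qed.

Lemma step_ge0 x : 0 <= step x.
Proof. by rewrite divr_ge0 ?flat_ge0. Qed.

Lemma step_le1 x : step x <= 1.
Proof.
by rewrite ler_pdivrMr ?step_scale_gt0 // mul1r flat0_homo // gerBl flat_ge0.
Qed.

Lemma step'_ge0 x : 0 <= step' x.
Proof. by rewrite divr_ge0 ?mulr_ge0 ?flat_ge0. Qed.

Lemma step'_out x : x \notin `]0, 1[ -> step' x = 0.
Proof.
rewrite in_itv /= negb_and -!leNgt => /orP[x0|x1]; rewrite /step'.
  by rewrite [flat 2 (_ - _)]flat_le0 ?mul0r // subr_le0 flat0_homo // lerBrDr gerDl.
by rewrite [flat 2 (1 - x)]flat_le0 ?mulr0 ?mul0r // subr_le0.
Qed.

Lemma smooth_step : smooth step.
Proof.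
apply: smoothM; last exact: smooth_cst.
apply: smooth_comp; first exact: smooth_flat.
rewrite (_ : (fun _ => _) = (fun x => flat 0 1 + (-1) * flat 0 ((-1) * x + 1))); last first.
  by apply/funext => x; rewrite !mulN1r [- x + 1]addrC.
apply: smoothD; first exact: smooth_cst.
apply: smoothM; first exact: smooth_cst.
apply: smooth_comp; [exact: smooth_flat|exact: smooth_affine].
Qed.

Lemma is_derive_step (x : R) : is_derive x 1 step (step' x).
Proof.
have d1 : is_derive x 1 (fun y : R => 1 - y) (-1).
  have := @is_deriveB R R R (cst 1) id x 1 _ _ (is_derive_cst _ _ _) (is_derive_id _ _).
  by rewrite sub0r.
have d2 := @is_derive1_comp R (flat 0) (fun y => 1 - y) x _ _ (is_derive_flat0 (1 - x)) d1.
have d3 : is_derive x 1 (fun y : R => flat 0 1 - (flat 0 \o (fun z => 1 - z)) y)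
    (0 - (flat 2 (1 - x) * -1)).
  by have := @is_deriveB R R R (cst (flat 0 1)) _ x 1 _ _ (is_derive_cst _ _ _) d2.
have d4 := @is_derive1_comp R (flat 0) _ x _ _ (is_derive_flat0 _) d3.
have d5 := is_deriveZ (flat 0 (flat 0 1))^-1 d4.
rewrite (_ : step = (flat 0 (flat 0 1))^-1 \*: (flat 0 \o
   (fun y : R => flat 0 1 - (flat 0 \o (fun z => 1 - z)) y))); last first.
  by apply/funext => y; rewrite /step mulrC.
apply: is_derive_eq; rewrite /GRing.scale /= /step'; ring.
Qed.

Lemma continuous_step' : continuous step'.
Proof.
apply: smooth_continuous; apply: smoothM; last exact: smooth_cst.
have h : smooth (fun x : R => 1 - x).
  rewrite (_ : (fun _ => _) = (fun x => (-1) * x + 1)); first exact: smooth_affine.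
  by apply/funext => x; rewrite mulN1r addrC.
apply: smoothM; last by apply: smooth_comp => //; exact: smooth_flat.
apply: smooth_comp; first exact: smooth_flat.
rewrite (_ : (fun _ => _) = (fun x => flat 0 1 + (-1) * flat 0 (1 - x))); last first.
  by apply/funext => x; rewrite mulN1r.
apply: smoothD; first exact: smooth_cst.
apply: smoothM; first exact: smooth_cst.
by apply: smooth_comp; first exact: smooth_flat.
Qed.

(** The derivative of a step rescaled to rise on [s, s + r]; it plays the role
    of an approximate Dirac mass at s. *)
Definition ramp (s r x : R) : R := r^-1 * step' ((x - s) / r).

Lemma ramp_ge0 s r x : 0 < r -> 0 <= ramp s r x.
Proof. by move=> r0; rewrite mulr_ge0 ?step'_ge0 // invr_ge0 ltW. Qed.

Lemma ramp_out s r x : 0 < r -> x \notin `]s, s + r[ -> ramp s r x = 0.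
Proof.
move=> r0 xsr; rewrite /ramp step'_out ?mulr0 //; apply: contra xsr.
by rewrite !in_itv /= ltr_pdivlMr // ltr_pdivrMr // mul0r mul1r subr_gt0 ltrBlDl.
Qed.

Lemma affineE (s r : R) : (fun x => (x - s) / r) = (fun x => r^-1 * x + (- (s / r))).
Proof. by apply/funext => x; rewrite mulrBl mulrC. Qed.

Lemma smooth_step_affine s r : smooth (fun x => step ((x - s) / r)).
Proof.
apply: smooth_comp; first exact: smooth_step.
by rewrite affineE; exact: smooth_affine.
Qed.

Lemma is_derive_step_affine s r (x : R) :
  is_derive x 1 (fun y => step ((y - s) / r)) (ramp s r x).
Proof.
have d1 : is_derive x 1 (fun y : R => (y - s) / r) r^-1.
  by rewrite affineE; exact: is_derive_affine.
have d2 := @is_derive1_comp R step (fun y => (y - s) / r) x _ _ (is_derive_step _) d1.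
by rewrite /ramp mulrC.
Qed.

Lemma continuous_ramp s r : continuous (ramp s r).
Proof.
move=> x; apply: cvgM; first exact: cvg_cst.
apply: (@continuous_comp _ _ _ (fun y => (y - s) / r) step'); last exact: continuous_step'.
apply: cvgM; last exact: cvg_cst.
by apply: cvgB; [exact: cvg_id|exact: cvg_cst].
Qed.

(** A difference of two steps rather than a product, so that its derivative is
    exactly a difference of two ramps. *)
Definition plateau (s t r x : R) : R := step ((x - s) / r) - step ((x - (t - r)) / r).

Section PlateauFacts.
Context (s t r : R) (r0 : 0 < r) (st : s + r <= t - r).

Lemma smooth_plateau : smooth (plateau s t r).
Proof.
rewrite (_ : plateau s t r = (fun x => step ((x - s) / r) + (-1) * step ((x - (t - r)) / r))).
  apply: smoothD; first exact: smooth_step_affine.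
  by apply: smoothM; [exact: smooth_cst|exact: smooth_step_affine].
by apply/funext => x; rewrite mulN1r.
Qed.

Lemma is_derive_plateau (x : R) :
  is_derive x 1 (plateau s t r) (ramp s r x - ramp (t - r) r x).
Proof. by apply: is_deriveB; exact: is_derive_step_affine. Qed.

Let stepL (a x : R) : x <= a -> step ((x - a) / r) = 0.
Proof. by move=> xa; rewrite step_le0 // ler_pdivrMr // mul0r subr_le0. Qed.

Let stepR (a x : R) : a + r <= x -> step ((x - a) / r) = 1.
Proof. by move=> xa; rewrite step_ge1 // ler_pdivlMr // mul1r lerBrDl. Qed.

Lemma plateau_in x : x \in `[s + r, t - r] -> plateau s t r x = 1.
Proof.
by rewrite in_itv /= => /andP[sx xt]; rewrite /plateau stepR // stepL // subr0.
Qed.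

Lemma plateau_out x : x \notin `[s, t] -> plateau s t r x = 0.
Proof.
rewrite in_itv /= negb_and -!ltNge /plateau => /orP[xs|tx].
  have h : x <= t - r by move: r0 st => a b; lra.
  by rewrite !stepL ?subrr // ltW.
have h : s + r <= x by move: r0 st => a b; lra.
by rewrite !stepR ?subrr ?subrK // ltW.
Qed.

Lemma plateau_ge0 x : 0 <= plateau s t r x.
Proof.
have [xt|tx] := leP x (t - r).
  by rewrite /plateau [X in _ - X]stepL // subr0 step_ge0.
have h : s + r <= x by move: r0 st => a b; lra.
by rewrite /plateau stepR ?subr_ge0 ?step_le1.
Qed.

Lemma plateau_le1 x : plateau s t r x <= 1.
Proof.
by rewrite /plateau lerBlDr (le_trans (step_le1 _)) // lerDl step_ge0.
Qed.

End PlateauFacts.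

End Plateau.

(** * Integration on the line *)

Section ComparisonWithoutMeasurability.
Context d (T : measurableType d) (R : realType).
Variable mu : {measure set T -> \bar R}.
Import HBNNSimple.

(** The integral of a nonnegative function is a supremum over the simple
    functions below it; a simple function can be set to 0 on the null set N
    without changing its integral.  This gives monotonicity for arbitrary
    functions, which spares the proof of joint measurability in the time variable
    of integrals that are themselves iterated. *)
Lemma ge0_le_integral_off_null (D N : set T) (f g : T -> \bar R) :
  measurable N -> mu N = 0%E ->
  (forall x, D x -> (0 <= f x)%E) -> (forall x, D x -> (0 <= g x)%E) ->
  (forall x, D x -> ~ N x -> (f x <= g x)%E) ->
  (\int[mu]_(x in D) f x <= \int[mu]_(x in D) g x)%E.
Proof.
move=> mN N0 f0 g0 fg; rewrite !ge0_integralE //.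
apply: ge_ereal_sup => _ [h /= hf <-].
pose h' : {nnsfun T >-> R} := mul_nnsfun h (indic_nnsfun R (measurableC mN)).
have h'E x : h' x = h x * \1_(~` N) x by [].
have -> : sintegral mu h = sintegral mu h'.
  rewrite -!integralT_nnsfun; apply: ge0_ae_eq_integral => //.
  - exact/measurable_EFinP/measurable_funP.
  - exact/measurable_EFinP/measurable_funP.
  - by move=> x _; rewrite lee_fin.
  - by move=> x _; rewrite lee_fin.
  exists N; split => // x /= xN; apply: contrapT => nx; apply: xN => _.
  by have := h'E x; rewrite /h' /= => ->; rewrite indicE mem_set // mulr1.
apply: ereal_sup_ubound; exists h' => //= x.
rewrite [X in (X%:E <= _)%E](_ : _ = h x * \1_(~` N) x) // indicE.
have [nx|nx] := boolP (x \in ~` N); last first.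
  by rewrite mulr0 erestrict_ge0.
rewrite mulr1; apply: le_trans (hf x) _; rewrite !patchE.
by case: ifPn => // xD; apply: fg; apply: set_mem.
Qed.

Lemma le_integral_off_null (D N : set T) (f g : T -> \bar R) :
  measurable N -> mu N = 0%E ->
  (forall x, D x -> ~ N x -> (f x <= g x)%E) ->
  (\int[mu]_(x in D) f x <= \int[mu]_(x in D) g x)%E.
Proof.
move=> mN N0 fg; rewrite integralE [leRHS]integralE; apply: leeB.
  apply: (ge0_le_integral_off_null D N) => // x Dx Nx.
  by apply: (@funepos_le _ _ [set x]); rewrite ?inE // => y /set_mem ->; exact: fg.
apply: (ge0_le_integral_off_null D N) => // x Dx Nx.
by apply: (@funeneg_le _ _ [set x]); rewrite ?inE // => y /set_mem ->; exact: fg.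
Qed.

(** Used for the time integrals of the weak formulation: the bounds give both
    the finiteness of the integral of f and its size. *)
Lemma Rintegral_squeeze (D N : set T) (c f e : T -> R) :
  measurable D -> measurable N -> mu N = 0%E ->
  mu.-integrable D (EFin \o c) -> mu.-integrable D (EFin \o e) ->
  (forall x, D x -> ~ N x -> c x <= f x <= e x) ->
  \int[mu]_(x in D) c x <= \int[mu]_(x in D) f x <= \int[mu]_(x in D) e x.
Proof.
move=> mD mN N0 ic ie cfe.
have cf : (\int[mu]_(x in D) (c x)%:E <= \int[mu]_(x in D) (f x)%:E)%E.
  by apply: (le_integral_off_null D N) => // x Dx /(cfe _ Dx)/andP[].
have fe : (\int[mu]_(x in D) (f x)%:E <= \int[mu]_(x in D) (e x)%:E)%E.
  by apply: (le_integral_off_null D N) => // x Dx /(cfe _ Dx)/andP[].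
have fc := integrable_fin_num mD ic.
have fe' := integrable_fin_num mD ie.
have ff : (\int[mu]_(x in D) (f x)%:E)%E \is a fin_num.
  rewrite fin_numElt (lt_le_trans _ cf) ?(le_lt_trans fe) //.
    by rewrite ltey_eq fe'.
  by rewrite ltNye_eq fc.
by rewrite /Rintegral !fine_le.
Qed.

End ComparisonWithoutMeasurability.

Section LebesgueLine.
Context {R : realType}.
Local Notation leb := (@lebesgue_measure R).

Lemma measurable_shift (h : R) :
  measurable_fun [set: measurableTypeR R] ((fun x => x + h) : measurableTypeR R -> measurableTypeR R).
Proof. by apply: measurable_funD. Qed.

(** Two measures that agree on half-open intervals are equal. *)
Lemma lebesgue_measure_shift (h : R) (A : set R) : measurable A ->
  leb A = pushforward leb (fun x : R => x + h) A.
Proof.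
move=> mA.
have mm := measurable_shift h.
pose m := @pushforward _ _ (measurableTypeR R) (measurableTypeR R) R leb (fun x => x + h).
have mE : m A = pushforward leb (fun x : R => x + h) A by [].
rewrite -mE.
apply: lebesgue_measure_unique => // _ [[a b] _ <-] /=.
rewrite /m /pushforward.
rewrite (_ : _ @^-1` _ = `]a - h, b - h]%classic); last first.
  by apply/seteqP; split => x /=; rewrite !in_itv /= ltrBlDr lerBrDr.
by rewrite !lebesgue_measure_itv /= !lte_fin ltrD2r -!EFinB opprB addrA subrK.
Qed.

Lemma ge0_integral_shift (h : R) (f : R -> \bar R) : measurable_fun setT f ->
  (forall x, 0 <= f x)%E -> (\int[leb]_x f (x + h)%R = \int[leb]_x f x)%E.
Proof.
move=> mf f0.
have := @ge0_integral_pushforward _ _ (measurableTypeR R) (measurableTypeR R) R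
  _ (measurable_shift h) leb setT f measurableT mf (fun x _ => f0 x).
rewrite preimage_setT => /= <-.
apply: eq_measure_integral => [|? A mA _ /=]; first exact: measurable_shift.
exact: (esym (lebesgue_measure_shift h _ mA)).
Qed.

Lemma integrable_shift (h : R) (f : R -> R) :
  leb.-integrable setT (EFin \o f) ->
  leb.-integrable setT (EFin \o (fun x => f (x + h))).
Proof.
move=> /integrableP[mf fi]; apply/integrableP; split.
  by apply: measurableT_comp mf _; exact: (measurable_shift h).
rewrite (ge0_integral_shift h (fun x => `|(f x)%:E|%E)) //.
exact: measurableT_comp.
Qed.

Lemma Rintegral_shift (h : R) (f : R -> R) :
  leb.-integrable setT (EFin \o f) ->
  \int[leb]_x f (x + h) = \int[leb]_x f x.
Proof.
move=> fi; congr fine; have [mf _] := integrableP _ _ _ fi.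
have := @integral_pushforward _ _ (measurableTypeR R) (measurableTypeR R) R
  _ (measurable_shift h) leb setT (EFin \o f) mf (integrable_shift h f fi) measurableT.
rewrite preimage_setT => /= <-.
apply: eq_measure_integral => [|? A mA _ /=]; first exact: measurable_shift.
exact: (esym (lebesgue_measure_shift h _ mA)).
Qed.

(** As g is Lipschitz in its first argument, g (p z) (q z) is the supremum over
    rational r of g r (q z) - C |p z - r|: its superlevel sets are countable
    unions of measurable sets. *)
Lemma measurable_lipschitz2 d (T : measurableType d) (g : R -> R -> R) (C : R)
    (p q : T -> R) : 0 <= C ->
  (forall a b a' b', `|g a b - g a' b'| <= C * (`|a - a'| + `|b - b'|)) ->
  measurable_fun setT p -> measurable_fun setT q ->
  measurable_fun setT (fun z => g (p z) (q z)).
Proof.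
move=> C0 gL mp mq.
have C1 : 0 < C + 1 by rewrite ltr_wpDl.
have mg a : measurable_fun setT (g a).
  apply: continuous_measurable_fun => b; apply/cvgrPdist_le => /= e e0.
  have e1 : 0 < e / (C + 1) by rewrite divr_gt0.
  apply/nbhs_ballP; exists (e / (C + 1)) => //= c; rewrite /ball /= => /ltW bc.
  apply: le_trans (gL _ _ _ _) _; rewrite subrr normr0 add0r.
  apply: le_trans (_ : (C + 1) * `|b - c| <= _).
    by rewrite ler_wpM2r // lerDl.
  by rewrite mulrC -ler_pdivlMr.
apply: (measurability _ (RGenOInfty.measurableE R)) => //.
move=> _ [_ [c ->] <-].
rewrite setTI.
rewrite (_ : _ @^-1` _ = \bigcup_(r : rat)
    [set z | c < g (ratr r) (q z) - C * `|p z - ratr r|]); last first.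
  apply/seteqP; split => z /=.
    rewrite in_itv /= andbT => cg.
    have C2 : 0 < C *+ 2 + 1 by rewrite ltr_wpDl // mulrn_wge0.
    (* With |p z - r| <= e, the loss is at most 2 C e, hence this value of e. *)
    pose e := (g (p z) (q z) - c) / (C *+ 2 + 1).
    have e0 : 0 < e by rewrite divr_gt0 // subr_gt0.
    have [r] : exists r, ratr r \in `]p z - e, p z + e[.
      by apply: rat_in_itvoo; lra.
    rewrite in_itv /= => /andP[r1 r2]; exists r => //=.
    have pr : `|p z - ratr r| <= e by rewrite ler_norml; apply/andP; split; lra.
    have := gL (p z) (q z) (ratr r) (q z); rewrite subrr normr0 addr0 => /ler_normlP[_ h].
    have : C * `|p z - ratr r| <= C * e by rewrite ler_wpM2l.
    have : (C *+ 2 + 1) * e = g (p z) (q z) - c by rewrite mulrC divfK ?gt_eqF.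
    rewrite mulrDl mul1r mulr2n mulrDl; lra.
  move=> [r _ /=]; rewrite in_itv /= andbT => cg; apply: lt_le_trans cg _.
  have := gL (p z) (q z) (ratr r) (q z); rewrite subrr normr0 addr0 => /ler_normlP[h _].
  lra.
apply: bigcupT_measurable_rat => r; rewrite -[X in measurable X]setTI.
apply: (@measurable_fun_ltr _ _ _ setT (cst c)) => //.
apply: measurable_funB; first exact: measurableT_comp.
apply: measurable_funM => //; apply: measurableT_comp => //.
exact: measurable_funB.
Qed.

(** Tonelli applied to the indicator of A. *)
Lemma product_null_sections (A : set (R * R)) : measurable A ->
  (leb \x leb)%E A = 0%E ->
  exists N : set R, [/\ measurable N, leb N = 0%E &
    forall t, ~ N t -> leb (ysection A t) = 0%E].
Proof.
move=> mA A0.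
have mf : measurable_fun setT (leb \o ysection A) by exact: measurable_fun_ysection.
have i0 : (\int[leb]_t `|(leb \o ysection A) t| = 0)%E.
  under eq_integral do rewrite gee0_abs //.
  have /= := @indic_fubini_tonelli _ _ _ _ R leb leb A mA.
  rewrite /fubini_F /fubini_G.
  have e := @indic_fubini_tonelli_FE _ _ _ _ R leb A mA.
  have e' := @indic_fubini_tonelli_GE _ _ _ _ R leb A mA.
  rewrite /fubini_F in e; rewrite /fubini_G in e'.
  by rewrite e e' => <-.
have [N [mN N0 h]] := (ae_eq_integral_abs leb measurableT mf).1 i0.
exists N; split => // t Nt; apply: contrapT => /= tA; apply: Nt; apply: h => /=.
by move=> /(_ Logic.I).
Qed.

(** The bound M is uniform in time, so that the estimates of the nonlocal term
    at almost every fixed time can be integrated over a window. *)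
Lemma Lfun_oo_sections (v : R * R -> R) :
  v \in Lfun (leb \x leb)%E +oo%E ->
  exists M : R, exists N : set R, [/\ measurable_fun setT v, measurable N, leb N = 0%E &
    forall t, ~ N t -> {ae leb, forall x, `|v (x, t)| <= M}].
Proof.
rewrite inE => /andP[]; rewrite inE /= => mv; rewrite inE /= /finite_norm unlock => nv.
have [M aeM] : exists M : R, {ae (leb \x leb)%E, forall p, `|v p| <= M}.
  move: nv; case: ifPn => [_|].
    have := @ess_supr_bounded _ _ R (leb \x leb)%E (Num.norm \o v).
    by rewrite (_ : EFin \o _ = abse \o (EFin \o v)) //; exact.
  (* The essential supremum norm is 0 by convention on a space of measure 0. *)
  rewrite -leNgt => m0 _; exists 0; exists setT; split => //.
  by apply/eqP; rewrite eq_le m0 measure_ge0.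
pose A : set (R * R) := [set p | M < `|v p|].
have mA : measurable A.
  rewrite -[A]setTI; apply: (@measurable_fun_ltr _ _ _ setT (cst M)) => //.
  exact: measurableT_comp.
have A0 : (leb \x leb)%E A = 0%E.
  have [N [mN N0 sN]] := aeM; apply/eqP; rewrite -measure_le0 -N0 le_measure ?inE // => p Ap.
  by apply: sN => /=; rewrite leNgt => /negP; exact.
have [N [mN N0 h]] := product_null_sections A mA A0.
exists M, N; split => // t Nt; exists (ysection A t); split.
- exact: measurable_ysection.
- exact: h.
- by move=> x /= xA; rewrite ysectionE /A /= ltNge; apply/negP.
Qed.

Lemma Rintegral_ramp (s r : R) (D : set R) : 0 < r -> `]s, s + r[ `<=` D ->
  \int[leb]_(t in D) ramp s r t = 1.
Proof.
move=> r0 sD.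
have sr : s < s + r by rewrite ltrDl.
have -> : \int[leb]_(t in D) ramp s r t = \int[leb]_(t in `[s, s + r]) ramp s r t.
  rewrite Rintegral_mkcond [RHS]Rintegral_mkcond; apply: eq_Rintegral => t _.
  rewrite !patchE; have [tsr|tsr] := boolP (t \in `]s, s + r[); last first.
    by rewrite ramp_out // !if_same.
  rewrite mem_set; last exact: sD.
  by rewrite mem_set //; exact: subset_itv_oo_cc.
rewrite /Rintegral.
pose F (x : R) := step ((x - s) / r).
have cF : continuous F by apply: smooth_continuous; exact: smooth_step_affine.
rewrite (@continuous_FTC2 R (ramp s r) F) //.
- rewrite /F step_ge1; last by rewrite addrAC subrr add0r divff // gt_eqF.
  by rewrite step_le0 ?subrr ?mul0r // sube0.
- by apply: continuous_subspaceT; exact: continuous_ramp.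
- split.
  + by move=> x _; have := is_derive_step_affine s r x.
  + by apply: cvg_at_right_filter; exact: cF.
  + by apply: cvg_at_left_filter; exact: cF.
- move=> x _; rewrite derive1E; have := is_derive_step_affine s r x => ?.
  by rewrite derive_val.
Qed.

Lemma continuous_supp_integrable (f : R -> R) (a b : R) : continuous f ->
  (forall x, x \notin `[a, b] -> f x = 0) -> leb.-integrable setT (EFin \o f).
Proof.
move=> cf f0.
have -> : EFin \o f = (EFin \o f) \_ `[a, b].
  apply/funext => x; rewrite patchE; case: ifPn => //= xab.
  by rewrite f0 //; apply: contra xab => xab; rewrite mem_set.
apply/integrable_restrict => //; rewrite setTI.
apply: continuous_compact_integrable; first exact: segment_compact.
exact: continuous_subspaceT.
Qed.

Lemma integrable_ramp (s r : R) : 0 < r -> leb.-integrable setT (EFin \o ramp s r).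
Proof.
move=> r0; apply: (@continuous_supp_integrable _ s (s + r)).
  exact: continuous_ramp.
move=> x xs; rewrite ramp_out //; apply: contra xs.
by rewrite !in_itv /= => /andP[/ltW -> /ltW ->].
Qed.

Lemma integrable_plateau (s t r : R) : 0 < r -> s + r <= t - r ->
  leb.-integrable setT (EFin \o plateau s t r).
Proof.
move=> r0 st; apply: (@continuous_supp_integrable _ s t).
  by apply: smooth_continuous; exact: smooth_plateau.
by move=> x; exact: plateau_out.
Qed.

End LebesgueLine.

(** * The nonlocal term at a fixed time *)

Section NonlocalEstimate.
Context {R : realType}.
Local Notation leb := (@lebesgue_measure R).

Lemma measurable_inv : measurable_fun setT (fun x : R => x^-1).
Proof.
rewrite -(setvU [set (0 : R)]); apply/measurable_funU => //.
  exact: measurableC.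
split; last exact: measurable_fun_set1.
apply: open_continuous_measurable_fun.
  by apply: closed_openC; exact: closed_eq.
by move=> x; rewrite inE /= => /eqP x0; exact: inv_continuous.
Qed.

(** Fubini for real-valued iterated integrals: integrability of every section
    makes the inner integrals finite, so that the coercion from extended reals
    loses nothing. *)
Lemma Rintegral_fubini (f : R * R -> R) :
  (leb \x leb)%E.-integrable setT (EFin \o f) ->
  (forall x, leb.-integrable setT (fun y => (f (x, y))%:E)) ->
  (forall y, leb.-integrable setT (fun x : R => (f (x, y))%:E)) ->
  \int[leb]_x \int[leb]_y f (x, y) = \int[leb]_y \int[leb]_x f (x, y).
Proof.
move=> fi fx fy.
have ex x : (\int[leb]_y (f (x, y))%:E = (\int[leb]_y f (x, y))%:E)%E.
  by rewrite fineK // integrable_fin_num.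
have ey y : (\int[leb]_x (f (x, y))%:E = (\int[leb]_x f (x, y))%:E)%E.
  by rewrite fineK // integrable_fin_num.
have := @Fubini _ _ _ _ R leb leb (EFin \o f) fi.
rewrite /=.
under eq_integral do rewrite ex.
under [in RHS]eq_integral do rewrite ey.
by move=> h; congr fine.
Qed.

Lemma integrable_tensor (a b : R -> R) :
  leb.-integrable setT (EFin \o a) -> leb.-integrable setT (EFin \o b) ->
  (leb \x leb)%E.-integrable setT (EFin \o tensor a b).
Proof.
move=> /integrableP[ma ia] /integrableP[mb ib].
apply/integrable12ltyP.
  apply/measurable_EFinP; apply: measurable_funM.
    by apply: measurableT_comp; [exact/measurable_EFinP|exact: measurable_fst].
  by apply: measurableT_comp; [exact/measurable_EFinP|exact: measurable_snd].
have -> : (\int[leb]_x \int[leb]_y `|(EFin \o tensor a b) (x, y)| =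
    \int[leb]_x (`|(a x)%:E| * \int[leb]_y `|(b y)%:E|))%E.
  apply: eq_integral => x _; rewrite -ge0_integralZl //; last exact: measurableT_comp.
  by apply: eq_integral => y _; rewrite /tensor /= normrM.
rewrite ge0_integralZr //; [|exact: measurableT_comp|exact: integral_ge0].
rewrite lte_mul_pinfty //; first exact: integral_ge0.
by rewrite ge0_fin_numE //; exact: integral_ge0.
Qed.

Lemma integrable_mul_bounded (al G : R -> R) (K : R) :
  leb.-integrable setT (EFin \o al) -> measurable_fun setT G ->
  (forall x, `|G x| <= K) ->
  leb.-integrable setT (EFin \o (fun x : R => al x * G x)).
Proof.
move=> ial mG GK.
apply: (@le_integrable _ _ _ leb setT _ _ (fun x : R => (K%:E * (al x)%:E)%E)) => //.
- apply/measurable_EFinP; apply: measurable_funM => //.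
  by apply/measurable_EFinP; have [] := integrableP _ _ _ ial.
- move=> x _ /=; rewrite lee_fin !normrM mulrC ler_wpM2r //.
  by rewrite (le_trans (GK x)) // ler_norm.
- exact: integrableZl.
Qed.

(** Discrete integration by parts: the difference quotient moves from the test
    function to the flux by translation invariance. *)
Lemma Rintegral_shift_difference (al G : R -> R) (K h : R) :
  leb.-integrable setT (EFin \o al) -> measurable_fun setT G ->
  (forall x, `|G x| <= K) ->
  \int[leb]_x ((al (x + h) - al x) * G x) =
  \int[leb]_x (al x * (G (x - h) - G x)).
Proof.
move=> ial mG GK.
have mGh : measurable_fun setT (fun x : R => G (x - h)).
  by apply: measurableT_comp => //; exact: (measurable_shift (- h)).
have i1 := integrable_mul_bounded al G K ial mG GK.
have i2 := integrable_mul_bounded al _ K ial mGh (fun x : R => GK _).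
have i3 : leb.-integrable setT (EFin \o (fun x : R => al (x + h) * G x)).
  by apply: (integrable_mul_bounded _ G K) => //; exact: integrable_shift.
transitivity (\int[leb]_x (al (x + h) * G x) - \int[leb]_x (al x * G x)).
  by rewrite -RintegralB //; apply: eq_Rintegral => x _; rewrite mulrBl.
transitivity (\int[leb]_x (al x * G (x - h)) - \int[leb]_x (al x * G x)).
  congr (_ - _); rewrite -[RHS](Rintegral_shift h) //.
  by apply: eq_Rintegral => x _; rewrite addrK.
by rewrite -RintegralB //; apply: eq_Rintegral => x _; rewrite mulrBr.
Qed.

Lemma Rintegral_indic_itv (a b : R) : a <= b -> \int[leb]_x \1_(`[a, b]) x = b - a.
Proof.
move=> ab; rewrite /Rintegral integral_indic // setIT /= lebesgue_measure_itv /= lte_fin.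
case: ltgtP ab => [||->]; rewrite ?subrr //= => ab _.
Qed.

Definition lipschitz_flux (C : R) (g : R -> R -> R) := forall u1 v1 u2 v2,
    `|g u1 v1 - g u2 v2| <= C * (`|u1 - u2| + `|v1 - v2|).

Lemma lipschitz_flux_bounded (C M : R) (g : R -> R -> R) (p q : R) :
  0 <= C -> lipschitz_flux C g -> `|p| <= M -> `|q| <= M ->
  `|g p q| <= `|g 0 0| + C * (M + M).
Proof.
move=> C0 gL pM qM; have := gL p q 0 0; rewrite !subr0 => H.
rewrite -[X in `|X|](subrK (g 0 0)) addrC (le_trans (ler_normD _ _)) // lerD2l.
by rewrite (le_trans H) // ler_wpM2l // lerD.
Qed.

(** A bound for the difference of the fluxes g(v, v(. + h)) at x - h and x. *)
Definition flux_variation (C h : R) (v : R -> R) (x : R) : R :=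
  C * (`|v (x - h) - v x| + `|v x - v (x + h)|).

Lemma flux_difference_variation (g : R -> R -> R) (C M h : R) (v al : R -> R) :
  0 <= C -> lipschitz_flux C g -> measurable_fun setT v -> (forall x, `|v x| <= M) ->
  leb.-integrable setT (EFin \o al) -> (forall x, 0 <= al x) ->
  leb.-integrable setT (EFin \o (fun x : R => al x * flux_variation C h v x)) /\
  `|\int[leb]_x ((al (x + h) - al x) * g (v x) (v (x + h)))|
     <= \int[leb]_x (al x * flux_variation C h v x).
Proof.
move=> C0 gL mv vM ial al0.
have mvh (k : R) : measurable_fun setT (fun x : R => v (x + k)).
  by apply: measurableT_comp => //; exact: measurable_shift.
have mG : measurable_fun setT (fun x : R => g (v x) (v (x + h))).
  exact: (measurable_lipschitz2 _ _ g C).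
have GK x : `|g (v x) (v (x + h))| <= `|g 0 0| + C * (M + M).
  exact: lipschitz_flux_bounded.
rewrite (Rintegral_shift_difference al (fun x : R => g (v x) (v (x + h))) _ h ial mG GK).
have mGh : measurable_fun setT (fun x : R => g (v (x - h)) (v (x - h + h))).
  apply: (measurableT_comp (f := fun x : R => g (v x) (v (x + h)))) => //.
  exact: (measurable_shift (- h)).
have iI : leb.-integrable setT (EFin \o (fun x : R =>
    al x * (g (v (x - h)) (v (x - h + h)) - g (v x) (v (x + h))))).
  apply: (integrable_mul_bounded _ _ ((`|g 0 0| + C * (M + M)) *+ 2)) => //.
    exact: measurable_funB.
  by move=> x; rewrite (le_trans (ler_normB _ _)) // mulr2n lerD // GK.
have tri p q : `|v p - v q| <= M + M by rewrite (le_trans (ler_normB _ _)) // lerD.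
have iV : leb.-integrable setT (EFin \o (fun x : R => al x * flux_variation C h v x)).
  apply: (integrable_mul_bounded _ _ (C * (M + M + (M + M)))) => //.
    apply: measurable_funM => //; apply: measurable_funD; apply: measurableT_comp => //.
      by apply: measurable_funB => //; exact: mvh.
    by apply: measurable_funB => //; exact: mvh.
  move=> x; rewrite ger0_norm; first by rewrite ler_wpM2l // lerD.
  by rewrite mulr_ge0 // addr_ge0.
split => //.
apply: le_trans (le_normr_Rintegral _ _) _ => //.
apply: le_Rintegral => //; first exact: integrable_norm.
move=> x _; rewrite normrM ger0_norm // ler_wpM2l //.
by have := gL (v (x - h)) (v (x - h + h)) (v x) (v (x + h)); rewrite subrK.
Qed.

(** For large h the flux difference is merely bounded, and the mass of the test
    function is the small factor. *)
Lemma flux_difference_far (g : R -> R -> R) (C M h : R) (v al : R -> R) :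
  0 <= C -> lipschitz_flux C g -> measurable_fun setT v -> (forall x, `|v x| <= M) ->
  leb.-integrable setT (EFin \o al) -> (forall x, 0 <= al x) ->
  `|\int[leb]_x ((al (x + h) - al x) * g (v x) (v (x + h)))|
     <= 4 * C * M * \int[leb]_x al x.
Proof.
move=> C0 gL mv vM ial al0.
have [iV] := flux_difference_variation g C M h v al C0 gL mv vM ial al0.
move=> /le_trans; apply; rewrite -RintegralZl //.
apply: le_Rintegral => //; first exact: (integrableZl measurableT (4 * C * M) ial).
move=> x _; rewrite mulrC ler_wpM2r //.
rewrite (_ : 4 * C * M = C * (M + M + (M + M))); last by ring.
have tri p q : `|v p - v q| <= M + M by rewrite (le_trans (ler_normB _ _)) // lerD.
by rewrite ler_wpM2l // lerD.
Qed.

(** The heart of the argument: for a function that is Lipschitz off a single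
    point xi, the flux difference at distance h has integral O(h).  The Lipschitz
    bound gives L h off the two intervals of length h around xi where one of the
    translates sits on the other side of xi; on these intervals the difference
    is O(1). *)
Lemma flux_difference_near (g : R -> R -> R) (C M L h a b xi : R) (v al : R -> R) :
  0 <= C -> lipschitz_flux C g -> measurable_fun setT v -> (forall x, `|v x| <= M) ->
  leb.-integrable setT (EFin \o al) ->
  (forall x, 0 <= al x <= 1) -> (forall x, x \notin `[a, b] -> al x = 0) ->
  a <= b -> 0 <= L -> 0 < h ->
  (forall x, x \in `[a - h, b] -> x + h < xi \/ xi < x -> `|v (x + h) - v x| <= L * h) ->
  `|\int[leb]_x ((al (x + h) - al x) * g (v x) (v (x + h)))|
     <= h * (2 * C * (L * (b - a) + 2 * M)).
Proof.
move=> C0 gL mv vM ial al01 al0 ab L0 h0 vL.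
have M0 : 0 <= M by apply: le_trans (vM 0).
have al_ge0 x : 0 <= al x by have /andP[] := al01 x.
have [iV] := flux_difference_variation g C M h v al C0 gL mv vM ial al_ge0.
move=> /le_trans; apply.
pose B x := (2 * C * L * h) * \1_(`[a, b]) x +
   ((2 * C * M) * \1_(`[xi, xi + h]) x + (2 * C * M) * \1_(`[xi - h, xi]) x).
have iZ c p q : leb.-integrable setT (EFin \o (fun x : R => c * \1_(`[p, q]) x : R)).
  exact: (integrableZl measurableT c (integrable_indic_itv p q true false)).
have i1 := iZ (2 * C * L * h) a b.
have i2 := iZ (2 * C * M) xi (xi + h); have i3 := iZ (2 * C * M) (xi - h) xi.
have i23 := integrableD measurableT i2 i3.
have iB : leb.-integrable setT (EFin \o B) := integrableD measurableT i1 i23.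
apply: (@le_trans _ _ (\int[leb]_x B x)).
  apply: le_Rintegral => // x _.
  have [xab|xab] := boolP (x \in `[a, b]); last first.
    by rewrite al0 // mul0r !addr_ge0 // !mulr_ge0 // ltW.
  have V0 : 0 <= flux_variation C h v x by rewrite mulr_ge0 // addr_ge0.
  apply: (@le_trans _ _ (flux_variation C h v x)).
    by rewrite -[leRHS]mul1r ler_wpM2r //; have /andP[] := al01 x.
  have tri p q : `|v p - v q| <= 2 * M.
    by rewrite (le_trans (ler_normB _ _)) // mulr2n mulrDl !mul1r lerD.
  have h1 : `|v (x - h) - v x| <= L * h + 2 * M * \1_(`[xi, xi + h]) x.
    have [xx|xx] := boolP (x \in `[xi, xi + h]).
      by rewrite indicE mem_set // mulr1 (le_trans (tri _ _)) // lerDr mulr_ge0 // ltW.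
    rewrite indicE memNset ?mulr0 ?addr0; last exact/negP.
    have := vL (x - h); rewrite subrK distrC; apply.
      by move: xab; rewrite !in_itv /= => /andP[? ?]; apply/andP; split; lra.
    move: xx; rewrite in_itv /= negb_and -!ltNge => /orP[?|?]; [by left|right].
    lra.
  have h2 : `|v x - v (x + h)| <= L * h + 2 * M * \1_(`[xi - h, xi]) x.
    have [xx|xx] := boolP (x \in `[xi - h, xi]).
      by rewrite indicE mem_set // mulr1 (le_trans (tri _ _)) // lerDr mulr_ge0 // ltW.
    rewrite indicE memNset ?mulr0 ?addr0; last exact/negP.
    have := vL x; rewrite distrC; apply.
      by move: xab; rewrite !in_itv /= => /andP[? ?]; apply/andP; split; lra.
    move: xx; rewrite in_itv /= negb_and -!ltNge => /orP[?|?]; [left|by right].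
    lra.
  rewrite /B [\1_(`[a, b]) x]indicE mem_set // mulr1.
  have := lerD h1 h2 => /(ler_wpM2l C0) /le_trans; apply.
  by rewrite le_eqVlt; apply/orP; left; apply/eqP; ring.
rewrite /B RintegralD // RintegralD //.
have Zi c p q : p <= q -> \int[leb]_x (c * \1_(`[p, q]) x) = c * (q - p).
  move=> pq; rewrite RintegralZl //; first by rewrite Rintegral_indic_itv.
  exact: (integrable_indic_itv p q true false).
rewrite !Zi ?lerDl ?gerBl ?(ltW h0) //.
by rewrite le_eqVlt; apply/orP; left; apply/eqP; ring.
Qed.

(** The inner double integral of the weak formulation, at a fixed time, for the
    profile v of the solution and the profile al of the test function. *)
Definition nonlocal_term (delta : R) (omega : R -> R) (g : R -> R -> R) (v al : R -> R) : R :=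
  \int[leb]_x \int[leb]_(h in `[0, delta])
     ((al (x + h) - al x) / h * g (v x) (v (x + h)) * omega h).

(** After exchanging the integrals in x and h, the x-integral divided by h is
    bounded by a constant for h <= eta and by a multiple of the mass of al, over
    eta, for h > eta.  The first constant comes with the mass of omega on
    [0, eta] only; this is the term that is made small by the choice of eta. *)
Lemma nonlocal_term_le (delta : R) (omega : R -> R) (g : R -> R -> R)
    (C M L A eta a b xi : R) (v al : R -> R) :
  nonlocal_kernel delta omega ->
  0 <= C -> lipschitz_flux C g -> measurable_fun setT v -> (forall x, `|v x| <= M) ->
  continuous al -> (forall x h, `|al (x + h) - al x| <= A * `|h|) ->
  (forall x, 0 <= al x <= 1) -> (forall x, x \notin `[a, b] -> al x = 0) ->
  a <= b -> 0 <= L -> 0 < eta ->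
  (forall h x, 0 < h <= eta -> x \in `[a - h, b] -> x + h < xi \/ xi < x ->
     `|v (x + h) - v x| <= L * h) ->
  `|nonlocal_term delta omega g v al| <=
    2 * C * (L * (b - a) + 2 * M) * \int[leb]_(h in `[0, eta]) omega h +
    4 * C * M / eta * \int[leb]_x al x.
Proof.
move=> [iom om_ge0 om_supp om_mass] C0 gL mv vM cal alA al01 al0 ab L0 eta0 vL.
have M0 : 0 <= M by apply: le_trans (vM 0).
have al_ge0 x : 0 <= al x by have /andP[] := al01 x.
have ial : leb.-integrable setT (EFin \o al) by apply: (continuous_supp_integrable _ a b).
have om0 h : h \notin `[0, delta] -> omega h = 0.
  move=> hd; apply: contrapT => /eqP oh; move/negP: hd; apply.
  by apply: om_supp; apply: subset_closure.
have A0 : 0 <= A by have := alA 0 1; rewrite normr1 mulr1; exact: le_trans.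
have mom : measurable_fun setT omega.
  by apply/measurable_EFinP; have [] := integrableP _ _ _ iom.
pose F (p : R * R) := (al (p.1 + p.2) - al p.1) / p.2 * g (v p.1) (v (p.1 + p.2)) * omega p.2.
have FE x h : F (x, h) = omega h / h * ((al (x + h) - al x) * g (v x) (v (x + h))).
  by rewrite /F /=; ring.
pose K := `|g 0 0| + C * (M + M).
have GK p q : `|g (v p) (v q)| <= K by exact: lipschitz_flux_bounded.
have m1 : measurable_fun setT (fst : R * R -> R) by exact: measurable_fst.
have m2 : measurable_fun setT (snd : R * R -> R) by exact: measurable_snd.
have m12 : measurable_fun setT (fun p : R * R => p.1 + p.2) by exact: measurable_funD.
have mal : measurable_fun setT al by exact: continuous_measurable_fun.
have mF : measurable_fun setT F.
  apply: measurable_funM; last exact: measurableT_comp.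
  apply: measurable_funM.
    apply: measurable_funM.
      by apply: measurable_funB; exact: measurableT_comp.
    by apply: (measurableT_comp measurable_inv).
  apply: (measurable_lipschitz2 _ _ g C) => //; exact: measurableT_comp.
(* As al is Lipschitz, the singular factor 1 / h is harmless before the exchange. *)
pose c x : R := (A * K) * \1_(`[a - delta, b]) x.
have c0 x : 0 <= c x by rewrite mulr_ge0 // mulr_ge0 // addr_ge0 // mulr_ge0 // addr_ge0.
have FB p : `|F p| <= c p.1 * omega p.2.
  case: p => x h /=; have [hd|hd] := boolP (h \in `[0, delta]); last first.
    by rewrite /F /= om0 // !mulr0 normr0.
  have [xa|xa] := boolP (x \in `[a - delta, b]); last first.
    have xh : x + h \notin `[a, b].
      by apply: contra xa; move: hd; rewrite !in_itv /= => /andP[? ?] /andP[? ?];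
        apply/andP; split; lra.
    have xab : x \notin `[a, b].
      apply: contra xa; move: hd; rewrite !in_itv /= => /andP[? ?] /andP[? ?].
      by apply/andP; split; lra.
    by rewrite /F /= (al0 _ xh) (al0 _ xab) subrr !mul0r normr0 mulr_ge0.
  rewrite /F /c /= indicE mem_set // mulr1 !normrM (ger0_norm (om_ge0 _)).
  rewrite ler_wpM2r // ler_pM // normfV.
  have [->|h0] := eqVneq h 0; first by rewrite normr0 invr0 mulr0.
  by rewrite ler_pdivrMr ?normr_gt0.
have ic : leb.-integrable setT (EFin \o c).
  exact: (integrableZl measurableT (A * K) (integrable_indic_itv (a - delta) b true false)).
have iF : (leb \x leb)%E.-integrable setT (EFin \o F).
  apply: (le_integrable _ _ _ (integrable_tensor _ _ ic iom)) => //.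
    exact/measurable_EFinP.
  by move=> p _ /=; rewrite lee_fin (le_trans (FB p)) // ler_norm.
have iFx x : leb.-integrable setT (fun h => (F (x, h))%:E).
  apply: (le_integrable _ _ _ (integrableZl measurableT (c x) iom)) => //.
    apply/measurable_EFinP; apply: (measurableT_comp mF); exact: pair1_measurable.
  by move=> h _ /=; rewrite lee_fin (le_trans (FB (x, h))) // ler_norm.
have iFy h : leb.-integrable setT (fun x => (F (x, h))%:E).
  apply: (le_integrable _ _ _ (integrableZl measurableT (omega h) ic)) => //.
    apply/measurable_EFinP; apply: (measurableT_comp mF); exact: pair2_measurable.
  by move=> x _ /=; rewrite lee_fin (le_trans (FB (x, h))) //= mulrC ler_norm.
have -> : nonlocal_term delta omega g v al = \int[leb]_h \int[leb]_x F (x, h).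
  rewrite -(Rintegral_fubini F iF iFx iFy); apply: eq_Rintegral => x _.
  rewrite Rintegral_mkcond; apply: eq_Rintegral => h _; rewrite patchE.
  case: ifPn => // hd; rewrite /F om0 ?mulr0 //.
  by apply: contra hd => hd; rewrite mem_set.
pose B1 := 2 * C * (L * (b - a) + 2 * M).
pose B2 := 4 * C * M / eta * \int[leb]_x al x.
pose B h := B1 * (omega \_ `[0, eta]) h + B2 * omega h.
have m0 : 0 <= \int[leb]_x al x by apply: Rintegral_ge0.
have B10 : 0 <= B1 by rewrite !mulr_ge0 // addr_ge0 ?mulr_ge0 // subr_ge0.
have B20 : 0 <= B2 by rewrite mulr_ge0 // divr_ge0 ?(ltW eta0) // !mulr_ge0.
have FI h : `|\int[leb]_x F (x, h)| <= B h.
  under eq_Rintegral do rewrite FE.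
  have p1 : 0 <= (omega \_ `[0, eta]) h by rewrite patchE; case: ifPn.
  have [h0|h0] := leP h 0.
    have -> : omega h / h = 0.
      have [->|hN0] := eqVneq h 0; first by rewrite invr0 mulr0.
      by rewrite om0 ?mul0r // in_itv /= negb_and -ltNge lt_neqAle hN0 h0.
    under eq_Rintegral do rewrite mul0r.
    by rewrite Rintegral_cst // mul0r normr0 addr_ge0 // mulr_ge0.
  have oh0 : 0 <= omega h / h by rewrite divr_ge0 // ltW.
  have mvh : measurable_fun setT (fun x : R => v (x + h)).
    by apply: measurableT_comp => //; exact: measurable_shift.
  rewrite RintegralZl //; last first.
    apply: (integrable_mul_bounded _ _ K) => //.
      exact: (integrableB measurableT (integrable_shift h al ial) ial).
    exact: (measurable_lipschitz2 _ _ g C).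
  rewrite normrM ger0_norm //.
  have [heta|heta] := leP h eta.
    have := flux_difference_near g C M L h a b xi v al C0 gL mv vM ial al01 al0 ab L0 h0.
    move=> /(_ _)/(ler_wpM2l oh0)/le_trans; apply.
      by move=> x; apply: vL; rewrite h0 heta.
    rewrite (mulrA (omega h / h) h) divfK ?gt_eqF // /B patchE mem_set /=; last by rewrite in_itv /= (ltW h0).
    by rewrite mulrC lerDl mulr_ge0.
  have := flux_difference_far g C M h v al C0 gL mv vM ial al_ge0.
  move=> /(ler_wpM2l oh0)/le_trans; apply.
  apply: (@le_trans _ _ (B2 * omega h)); last by rewrite lerDr mulr_ge0.
  rewrite [leRHS]mulrC -[X in X <= _]mulrA ler_wpM2l // mulrC /B2.
  rewrite [leLHS]mulrAC ler_wpM2r // ler_wpM2l ?mulr_ge0 // lef_pV2 //.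
  by rewrite ltW.
have iB1 : leb.-integrable setT (EFin \o (omega \_ `[0, eta])).
  rewrite -restrict_EFin; apply/integrable_restrict => //; rewrite setTI.
  exact: (integrableS measurableT).
have iB1' := integrableZl measurableT B1 iB1.
have iB2' := integrableZl measurableT B2 iom.
have iB : leb.-integrable setT (EFin \o B) := integrableD measurableT iB1' iB2'.
have iNB : leb.-integrable setT (EFin \o (fun h => - B h)) := integrableN iB.
have BE : \int[leb]_h B h = B1 * \int[leb]_(h in `[0, eta]) omega h + B2.
  rewrite RintegralD // RintegralZl // RintegralZl // -Rintegral_mkcond; congr (_ + _).
  rewrite -[RHS]mulr1 -om_mass Rintegral_mkcond [X in _ = _ * X]Rintegral_mkcond.
  congr (_ * _); apply: eq_Rintegral => h _; rewrite !patchE.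
  rewrite mem_set //; case: ifPn => // hd; rewrite om0 //.
  by apply: contra hd => hd; rewrite mem_set.
have := Rintegral_squeeze _ _ _ leb setT set0 (fun h => - B h)
  (fun h => \int[leb]_x F (x, h)) B measurableT measurable0 (measure0 _) iNB iB.
have -> : \int[leb]_h (- B h) = - \int[leb]_h B h.
  under eq_Rintegral do rewrite -mulN1r.
  by rewrite RintegralZl // mulN1r.
rewrite -ler_norml BE; apply => h _ _; rewrite -ler_norml.
exact: FI.
Qed.

End NonlocalEstimate.

(** * The weak formulation on a time window *)

Lemma eq_Rintegral_off_null d (T : measurableType d) (R : realType)
    (mu : {measure set T -> \bar R}) (D N : set T) (f g : T -> R) :
  measurable N -> mu N = 0%E -> (forall x, D x -> ~ N x -> f x = g x) ->
  \int[mu]_(x in D) f x = \int[mu]_(x in D) g x.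
Proof.
move=> mN N0 fg; congr fine; apply/eqP; rewrite eq_le; apply/andP; split.
  by apply: (le_integral_off_null _ _ _ _ _ N) => // x Dx Nx; rewrite fg.
by apply: (le_integral_off_null _ _ _ _ _ N) => // x Dx Nx; rewrite fg.
Qed.

Section TimeSlices.
Context {R : realType}.
Local Notation leb := (@lebesgue_measure R).

(** Translates of a null set are null, so neither the integral in h nor the
    integral in x sees the change of v on N. *)
Lemma nonlocal_term_ae_eq (delta : R) (omega : R -> R) (g : R -> R -> R)
    (v w al : R -> R) (N : set R) :
  measurable N -> leb N = 0%E -> (forall x, ~ N x -> v x = w x) ->
  nonlocal_term delta omega g v al = nonlocal_term delta omega g w al.
Proof.
move=> mN N0 vw; rewrite /nonlocal_term.
apply: (eq_Rintegral_off_null _ _ _ leb setT (N : set (measurableTypeR R))) => // x _ Nx.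
pose Nx' := (fun h : R => h + x) @^-1` N.
have mNx : measurable Nx'.
  by rewrite -[Nx']setTI; apply: (measurable_shift x) => //.
apply: (eq_Rintegral_off_null _ _ _ leb _ (Nx' : set (measurableTypeR R))) => //.
  by have := lebesgue_measure_shift x _ mN; rewrite N0.
by move=> h _ Nh; rewrite !vw // addrC.
Qed.

(** Truncation to [- M, M] turns an essentially bounded profile into a bounded
    one while preserving its Lipschitz bounds. *)
Definition clamp (M a : R) : R := Num.max (- M) (Num.min a M).

Lemma clamp_bounded (M a : R) : 0 <= M -> `|clamp M a| <= M.
Proof.
by move=> M0; rewrite ler_norml /clamp le_max lexx /= ge_max ge_min lexx orbT andbT; lra.
Qed.

Lemma clamp_id (M a : R) : `|a| <= M -> clamp M a = a.
Proof. by rewrite ler_norml /clamp => /andP[h1 h2]; rewrite min_l // max_r. Qed.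

Lemma clamp_lipschitz (M a b : R) : `|clamp M a - clamp M b| <= `|a - b|.
Proof.
rewrite /clamp; wlog ab : a b / a <= b.
  move=> H; have [ab|/ltW ab] := leP a b; first exact: H.
  by rewrite distrC [leRHS]distrC H.
rewrite distrC [leRHS]distrC.
have m1 : Num.min a M <= Num.min b M by rewrite le_min !ge_min ab lexx orbT.
have m2 : Num.min b M - Num.min a M <= b - a.
  by rewrite /Num.min; do 2 case: ifPn => ?; lra.
rewrite !ger0_norm ?subr_ge0 //; last by rewrite le_max2 ?lexx.
apply: le_trans m2; rewrite /Num.max; do 2 case: ifPn => ?; lra.
Qed.

Lemma nonlocal_term_ae_le (delta : R) (omega : R -> R) (g : R -> R -> R)
    (C M L A eta a b xi : R) (v al : R -> R) :
  nonlocal_kernel delta omega ->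
  0 <= C -> lipschitz_flux C g -> 0 <= M -> measurable_fun setT v ->
  {ae leb, forall x, `|v x| <= M} ->
  continuous al -> (forall x h, `|al (x + h) - al x| <= A * `|h|) ->
  (forall x, 0 <= al x <= 1) -> (forall x, x \notin `[a, b] -> al x = 0) ->
  a <= b -> 0 <= L -> 0 < eta ->
  (forall h x, 0 < h <= eta -> x \in `[a - h, b] -> x + h < xi \/ xi < x ->
     `|v (x + h) - v x| <= L * h) ->
  `|nonlocal_term delta omega g v al| <=
    2 * C * (L * (b - a) + 2 * M) * \int[leb]_(h in `[0, eta]) omega h +
    4 * C * M / eta * \int[leb]_x al x.
Proof.
move=> ker C0 gL M0 mv [N [mN N0 vN]] cal alA al01 al0 ab L0 eta0 vL.
rewrite (nonlocal_term_ae_eq _ _ _ v (clamp M \o v) _ N) //; last first.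
  by move=> x Nx /=; rewrite clamp_id //; apply: contrapT => h; apply: Nx; exact: vN.
apply: (nonlocal_term_le _ _ _ _ _ L A eta a b xi) => //.
- apply: measurable_maxr => //; exact: measurable_minr.
- by move=> x; exact: clamp_bounded.
- by move=> h x h0 xab hx; apply: le_trans (clamp_lipschitz _ _ _) _; exact: vL.
Qed.

Lemma measurable_time_slice (T : R) (u : R * R -> R) (t : R) :
  measurable_fun setT (u \_ (setT `*` `]0, T[)) -> t \in `]0, T[ ->
  measurable_fun setT (fun x : R => u (x, t)).
Proof.
move=> mu tT.
rewrite (_ : (fun _ => _) = (u \_ (setT `*` `]0, T[)) \o (fun x : R => (x, t))).
  by apply: measurableT_comp => //; exact: pair2_measurable.
by apply/funext => x /=; rewrite patchE mem_set.
Qed.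

Lemma slice_average (v al : R -> R) (P e a b : R) :
  measurable_fun setT v -> leb.-integrable setT (EFin \o al) ->
  (forall x, 0 <= al x) -> (forall x, x \notin `[a, b] -> al x = 0) ->
  (forall x, x \in `[a, b] -> `|v x - P| <= e) ->
  leb.-integrable setT (EFin \o (fun x : R => v x * al x)) /\
  (P - e) * \int[leb]_x al x <= \int[leb]_x (v x * al x) <= (P + e) * \int[leb]_x al x.
Proof.
move=> mv ial al0 al_out vP.
have bnd x : (P - e) * al x <= v x * al x <= (P + e) * al x.
  have [xab|xab] := boolP (x \in `[a, b]); last by rewrite al_out // !mulr0 lexx.
  have := vP x xab; rewrite ler_distl => /andP[? ?].
  by rewrite !ler_wpM2r.
have iv : leb.-integrable setT (EFin \o (fun x : R => v x * al x)).
  apply: (le_integrable _ _ _ (integrableZl measurableT (`|P| + e) ial)) => //.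
    apply/measurable_EFinP; apply: measurable_funM => //.
    by apply/measurable_EFinP; have [] := integrableP _ _ _ ial.
  move=> x _ /=; rewrite lee_fin !normrM.
  have [xab|xab] := boolP (x \in `[a, b]); last by rewrite al_out // normr0 !mulr0.
  rewrite ler_wpM2r //; have := vP x xab => H.
  rewrite -[X in `|X| <= _](subrK P) (le_trans (ler_normD _ _)) // addrC.
  by rewrite (le_trans _ (ler_norm _)) // lerD2l.
split => //; rewrite -!RintegralZl //; apply/andP; split; apply: le_Rintegral => //.
- exact: (integrableZl measurableT (P - e) ial).
- by move=> x _; have /andP[] := bnd x.
- exact: (integrableZl measurableT (P + e) ial).
- by move=> x _; have /andP[] := bnd x.
Qed.

Lemma Rintegral_ramp_comb (s t r p q : R) (D : set (measurableTypeR R)) : measurable D ->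
  0 < r -> `]s, s + r[ `<=` D -> `]t, t + r[ `<=` D ->
  leb.-integrable D (EFin \o (fun x : R => p * ramp s r x - q * ramp t r x)) /\
  \int[leb]_(x in D) (p * ramp s r x - q * ramp t r x) = p - q.
Proof.
move=> mD r0 sD tD.
have i1 (a : R) : leb.-integrable D (EFin \o ramp a r).
  by apply: (integrableS measurableT) => //; exact: integrable_ramp.
have i2 (c a : R) : leb.-integrable D (EFin \o (fun x : R => c * ramp a r x)).
  exact: (integrableZl mD c (i1 a)).
split; first exact: (integrableB mD (i2 p s) (i2 q t)).
by rewrite RintegralB // [X in X - _]RintegralZl // [X in _ - X]RintegralZl // !Rintegral_ramp // !mulr1.
Qed.

Lemma distance_of_bounds (P Q e m I : R) :
  (P - e) * m - (Q + e) * m <= I <= (P + e) * m - (Q - e) * m ->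
  `|P * m - Q * m| <= `|I| + 2 * e * m.
Proof.
rewrite !mulrBl !mulrDl => /andP[h1 h2].
have i1 := ler_norm I; have i2 := ler_norm (- I); rewrite normrN in i2.
by rewrite ler_norml; apply/andP; split; lra.
Qed.

(** The weak formulation tested with al(x) beta(t), beta a plateau on [s, t]
    with a short rise time.  The time derivative of beta is an approximate Dirac
    mass at s minus one at t, and on the support of al the solution is close to P
    just after s and to Q just before t: the first term is (P - Q) m up to 2 e m,
    where m is the mass of al.  The factor k in the bound on the nonlocal term
    stands for the values of beta. *)
Lemma window_estimate (T delta : R) (omega : R -> R) (g : R -> R -> R)
    (u0 : R -> R) (u : R * R -> R) (N : set R)
    (s t r0 a b P Q e Theta : R) (al : R -> R) :
  weak_solution T delta omega g u0 u ->
  0 < s -> s < t -> t < T -> 0 < r0 ->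
  smooth al -> (forall x, 0 <= al x) -> (forall x, x \notin `[a, b] -> al x = 0) ->
  (forall tau x, tau \in `]s, s + r0[ -> x \in `[a, b] -> `|u (x, tau) - P| <= e) ->
  (forall tau x, tau \in `]t - r0, t[ -> x \in `[a, b] -> `|u (x, tau) - Q| <= e) ->
  measurable N -> leb N = 0%E -> 0 <= Theta ->
  (forall tau k, ~ N tau -> tau \in `[s, t] -> 0 <= k <= 1 ->
     `|nonlocal_term delta omega g (fun x : R => u (x, tau)) (fun x : R => al x * k)| <= Theta) ->
  (`|P - Q| - 2 * e) * \int[leb]_x al x <= (t - s) * Theta.
Proof.
move=> [uL uweak] s0 st tT r00 sal al0 al_out uP uQ mN N0 Theta0 nonloc.
have mu : measurable_fun setT (u \_ (setT `*` `]0, T[)).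
  by have [M [N' []]] := Lfun_oo_sections _ uL.
have mv tau : tau \in `]0, T[ -> measurable_fun setT (fun x : R => u (x, tau)).
  exact: measurable_time_slice.
have ial : leb.-integrable setT (EFin \o al).
  by apply: (continuous_supp_integrable _ a b) => //; exact: smooth_continuous.
pose r := Num.min r0 ((t - s) / 2).
have rr0 : r <= r0 by rewrite ge_min lexx.
have r_gt0 : 0 < r by rewrite lt_min r00 divr_gt0 // subr_gt0.
have str : s + r <= t - r.
  have : r <= (t - s) / 2 by rewrite ge_min lexx orbT.
  by rewrite ler_pdivlMr //; lra.
pose be := plateau s t r.
pose be' x := ramp s r x - ramp (t - r) r x.
have be_out tau : tau \notin `[s, t] -> be tau = 0 by exact: plateau_out.
have sbe : smooth be by exact: smooth_plateau.
have tst : test_function T (tensor al be).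
  exact: (tensor_test_function T al be a b s t).
have := uweak _ tst.
have -> : dt (tensor al be) = tensor al be'.
  by apply: tensor_dt => // x; exact: is_derive_plateau.
set m := \int[leb]_x al x.
have -> : \int[leb]_x (u0 x * tensor al be (x, 0)) = 0.
  have -> : (fun x : R => u0 x * tensor al be (x, 0)) = cst 0.
    apply/funext => x; rewrite /tensor /= be_out ?mulr0 //.
    by rewrite in_itv /= negb_and -!ltNge s0.
  by rewrite Rintegral_cst // mul0r.
rewrite addr0.
set I1 := (X in X + _); set I2 := (X in _ + X) => I12.
have s_sub : `]s, s + r[ `<=` `]0, T[%classic.
  by move=> x /=; rewrite !in_itv /= => /andP[? ?]; apply/andP; split; lra.
have t_sub : `](t - r), (t - r + r)[ `<=` `]0, T[%classic.
  by move=> x /=; rewrite !in_itv /= => /andP[? ?]; apply/andP; split; lra.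
(* The integrand of I1 lies between two combinations of ramps, whose integrals
   are known exactly. *)
have I1_bounds : ((P - e) * m - (Q + e) * m) <= I1 <= ((P + e) * m - (Q - e) * m).
  have [ic <-] := Rintegral_ramp_comb s (t - r) r ((P - e) * m) ((Q + e) * m) _
    (measurable_itv _) r_gt0 s_sub t_sub.
  have [ie <-] := Rintegral_ramp_comb s (t - r) r ((P + e) * m) ((Q - e) * m) _
    (measurable_itv _) r_gt0 s_sub t_sub.
  apply: (Rintegral_squeeze _ _ _ _ _ set0) => // tau tauT _.
  have tauT' : tau \in `]0, T[ by [].
  have [taus|taus] := boolP (tau \in `]s, s + r[).
    have taut : tau \notin `](t - r), (t - r + r)[.
      apply: contraL taus; rewrite !in_itv /= => /andP[? ?].
      by rewrite negb_and -!leNgt; apply/orP; right; lra.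
    have [iv bv] := slice_average (fun x : R => u (x, tau)) al P e a b (mv _ tauT') ial al0 al_out
      (fun x xab => uP tau x ltac:(by move: taus; rewrite !in_itv /= => /andP[-> ?] /=; lra) xab).
    rewrite /be' /tensor /=.
    under eq_Rintegral do rewrite (ramp_out _ _ _ r_gt0 taut) subr0 mulrA.
    rewrite (ramp_out _ _ _ r_gt0 taut) !mulr0 !subr0 RintegralZr //.
    by move: bv; rewrite -/m => /andP[b1 b2]; apply/andP; split; rewrite ler_wpM2r ?ramp_ge0.
  have [taut|taut] := boolP (tau \in `](t - r), (t - r + r)[).
    have [iv bv] := slice_average (fun x : R => u (x, tau)) al Q e a b (mv _ tauT') ial al0 al_out
      (fun x xab => uQ tau x ltac:(by move: taut; rewrite !in_itv /= => /andP[? ?]; apply/andP; split; lra) xab).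
    rewrite /be' /tensor /=.
    under eq_Rintegral do rewrite (ramp_out _ _ _ r_gt0 taus) sub0r mulrA.
    rewrite (ramp_out _ _ _ r_gt0 taus) !mulr0 !sub0r RintegralZr //.
    rewrite mulrN !lerN2.
    by move: bv; rewrite -/m => /andP[b1 b2]; apply/andP; split; rewrite ler_wpM2r ?ramp_ge0.
  rewrite !(ramp_out _ _ _ r_gt0 taus) !(ramp_out _ _ _ r_gt0 taut) !mulr0 subrr.
  rewrite /be' /tensor /=.
  under eq_Rintegral do
    rewrite (ramp_out _ _ _ r_gt0 taus) (ramp_out _ _ _ r_gt0 taut) subrr !mulr0.
  by rewrite Rintegral_cst // mul0r lexx.
have I2_bound : `|I2| <= (t - s) * Theta.
  pose ind x : R := Theta * \1_(`[s, t]) x.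
  have ii : leb.-integrable `]0, T[ (EFin \o ind).
    apply: (integrableS measurableT) => //.
    exact: (integrableZl measurableT Theta (integrable_indic_itv s t true false)).
  have iN : leb.-integrable `]0, T[ (EFin \o (fun x : R => - ind x)) := integrableN ii.
  have indE : \int[leb]_(x in `]0, T[) ind x = (t - s) * Theta.
    rewrite Rintegral_mkcond mulrC.
    rewrite (_ : _ \_ _ = (fun x : R => Theta * \1_(`[s, t]) x)); last first.
      apply/funext => x; rewrite patchE; case: ifPn => // xT.
      rewrite indicE memNset ?mulr0 //=; apply: contraNnot xT => xst.
      rewrite mem_set //=; move: xst; rewrite !in_itv /= => /andP[? ?].
      by apply/andP; split; lra.
    rewrite RintegralZl //; last exact: (integrable_indic_itv s t true false).
    by rewrite Rintegral_indic_itv // ltW.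
  have NindE : \int[leb]_(x in `]0, T[) (- ind x) = - ((t - s) * Theta).
    by under eq_Rintegral do rewrite -mulN1r; rewrite RintegralZl // mulN1r indE.
  rewrite ler_norml -{1}NindE -indE.
  apply: (Rintegral_squeeze _ _ _ leb _ (N : set (measurableTypeR R))) => // tau tauT Ntau.
  rewrite -ler_norml /ind.
  have [taust|taust] := boolP (tau \in `[s, t]).
    rewrite indicE mem_set // mulr1; apply: (nonloc tau (be tau)) => //.
    by rewrite plateau_ge0 ?plateau_le1.
  rewrite indicE memNset ?mulr0; last exact/negP.
  have -> : (fun x : R => \int[leb]_(h in `[0, delta])
     ((tensor al be (x + h, tau) - tensor al be (x, tau)) / h *
       g (u (x, tau)) (u (x + h, tau)) * omega h)) = cst 0.
    apply/funext => x; rewrite /tensor /= be_out //.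
    under eq_Rintegral do rewrite !mulr0 subrr !mul0r.
    by rewrite Rintegral_cst // mul0r.
  by rewrite Rintegral_cst // mul0r normr0.
have : `|I1| <= (t - s) * Theta.
  by rewrite (_ : I1 = - I2) ?normrN //; apply/eqP; rewrite -addr_eq0 I12.
have m0 : 0 <= m by apply: Rintegral_ge0.
have PQ := distance_of_bounds P Q e m I1 I1_bounds.
move=> I1T; rewrite mulrBl.
have -> : `|P - Q| * m = `|P * m - Q * m| by rewrite -mulrBl normrM (ger0_norm m0).
by rewrite lerBlDr (le_trans PQ) // lerD2r.
Qed.

End TimeSlices.

(** * The solution near its discontinuity *)

Section NearTheJump.
Context {R : realType}.

Lemma derivative_bound_lipschitz (f f' : R -> R) (a b L : R) :
  a <= b -> (forall x, x \in `[a, b] -> is_derive x 1 f (f' x)) ->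
  (forall x, x \in `[a, b] -> `|f' x| <= L) -> `|f b - f a| <= L * (b - a).
Proof.
move=> ab df bf.
have cf : {within `[a, b], continuous f}.
  by apply: derivable_within_continuous => x xab; have := df x xab.
have [c cab ->] := MVT_segment ab (fun x xab => df x (subset_itv_oo_cc xab)) cf.
by rewrite normrM (ger0_norm (_ : 0 <= b - a)) ?subr_ge0 // ler_wpM2r ?subr_ge0 ?bf.
Qed.

Lemma step'_bounded : exists K : R, forall x : R, `|step' x| <= K.
Proof.
have c : {within `[0, 1], continuous (step' : R -> R)}.
  by apply: continuous_subspaceT; exact: continuous_step'.
have [k _ hk] := EVT_max ler01 c.
exists (step' k) => x; rewrite ger0_norm ?step'_ge0 //.
have [x01|x01] := boolP (x \in `]0, 1[); last by rewrite step'_out ?step'_ge0.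
by apply: hk; exact: subset_itv_oo_cc.
Qed.

Lemma plateau_lipschitz (s t r : R) : 0 < r ->
  exists K : R, forall x h, `|plateau s t r (x + h) - plateau s t r x| <= K * `|h|.
Proof.
move=> r0; have [K0 hK] := step'_bounded; exists (r^-1 * K0 *+ 2).
have rb a x : `|ramp a r x| <= r^-1 * K0.
  have ri : 0 <= r^-1 by rewrite invr_ge0 ltW.
  by rewrite normrM (ger0_norm ri) ler_wpM2l.
have bnd x : `|ramp s r x - ramp (t - r) r x| <= r^-1 * K0 *+ 2.
  by rewrite (le_trans (ler_normB _ _)) // mulr2n lerD.
move=> x h; have [h0|h0] := leP 0 h.
  have xh : x <= x + h by rewrite lerDl.
  have := derivative_bound_lipschitz (plateau s t r) _ x (x + h) _ xh
    (fun y _ => is_derive_plateau s t r y) (fun y _ => bnd y).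
  by rewrite (_ : x + h - x = h) ?(ger0_norm h0) //; ring.
have xh : x + h <= x by rewrite gerDl ltW.
have := derivative_bound_lipschitz (plateau s t r) _ (x + h) x _ xh
    (fun y _ => is_derive_plateau s t r y) (fun y _ => bnd y).
by rewrite distrC (ltr0_norm h0) (_ : x - (x + h) = - h) //; ring.
Qed.

Lemma slice_is_derive (u : R * R -> R) (y t : R) : differentiable u (y, t) ->
  is_derive y 1 (fun z => u (z, t)) (dx u (y, t)).
Proof.
move=> du.
have E : (fun h : R => h^-1 *: (((fun z => u (z, t)) \o shift y) (h *: 1) - u (y, t))) =
         (fun h : R => h^-1 *: ((u \o shift (y, t)) (h *: (1, 0)) - u (y, t))).
  apply/funext => h /=; congr (_ *: (u _ - _)).
  rewrite (_ : h *: (1, 0) + (y, t) = (h *: 1 + y, h *: 0 + t)) //.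
  by rewrite scaler0 add0r.
have dd : derivable u (y, t) (1, 0) by exact: diff_derivable.
apply: DeriveDef; first by rewrite /derivable E.
by rewrite /derive E.
Qed.

(** A function with a finite limit at p is bounded near p; for the x-derivative
    of u, this is the source of the Lipschitz constant L. *)
Lemma C1_up_to_bounds (A G : set (R * R)) (u : R * R -> R) (p : R * R) :
  C1_up_to A G u -> G p ->
  exists l, u q @[q --> within A (nbhs p)] --> l /\
   forall e, 0 < e -> exists r, exists L, [/\ 0 < r, 0 <= L &
    forall q, A q -> `|q.1 - p.1| < r -> `|q.2 - p.2| < r ->
      `|u q - l| <= e /\ `|dx u q| <= L].
Proof.
move=> [_ _ _ lims] Gp; have [cu cdx _] := lims p Gp.
exists (lim (u q @[q --> within A (nbhs p)])); split => // e e0.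
move: cu cdx => /cvgrPdist_le /(_ e e0) + /cvgrPdist_le /(_ 1 ltr01).
rewrite !near_withinE => /nbhs_ballP[r1 /= r10 h1] /nbhs_ballP[r2 /= r20 h2].
set l' := lim _ in h2.
exists (Num.min r1 r2), (`|l'| + 1); split.
- by rewrite lt_min r10.
- by rewrite addr_ge0.
move=> q Aq; rewrite !lt_min => /andP[a1 a2] /andP[b1 b2]; split.
  rewrite distrC; apply: h1 => //; split; rewrite /ball /= distrC //.
have := h2 q; rewrite /= => /(_ _ Aq) H.
rewrite -[X in `|X|](subrK l') addrC (le_trans (ler_normD _ _)) // lerD2l distrC.
by apply: H; split; rewrite /ball /= distrC.
Qed.

Lemma ball_between (c r a b w : R) : `|a - c| < r -> `|b - c| < r ->
  a <= w <= b -> `|w - c| < r.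
Proof.
rewrite !ltr_norml => /andP[? ?] /andP[? ?] /andP[? ?].
by apply/andP; split; lra.
Qed.

(** What the argument retains of the piecewise C^1 structure, on a box of
    half-width r around the point (x t0, t0). *)
Definition jump_control (T : R) (x : R -> R) (u : R * R -> R)
    (t0 um up e r L : R) : Prop :=
  [/\ forall t, `|t - t0| < r -> 0 < t < T,
      forall t y, `|t - t0| < r -> `|y - x t0| < r ->
        (y < x t -> `|u (y, t) - um| <= e) /\ (x t < y -> `|u (y, t) - up| <= e) &
      forall t y z, `|t - t0| < r -> `|y - x t0| < r -> `|z - x t0| < r -> y <= z ->
        z < x t \/ x t < y -> `|u (z, t) - u (y, t)| <= L * (z - y)].

(** The limits of u at (x t0, t0) from each side region agree with the limits
    along the horizontal line t = t0, so that they are distinct; the Lipschitz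
    bound is the mean value inequality on horizontal segments, which stay on one
    side of the curve. *)
Lemma jump_control_exists (T : R) (I : set R) (x : R -> R) (u : R * R -> R) (t0 : R) :
  piecewise_C1_with_jump T I x u -> I° t0 ->
  exists um, exists up, um != up /\ forall e, 0 < e -> exists r, exists L,
  [/\ 0 < r, 0 <= L, forall t, `|t - t0| < r -> I t & jump_control T x u t0 um up e r L].
Proof.
move=> [cx /(_ t0)] /[apply] -[[D [oD Dp DT cl cr]] [um [up [lm lp umup]]]].
have Gp : (D `&` [set p | p.1 = x p.2]) (x t0, t0) by [].
have [l1 [hl1 bl]] := C1_up_to_bounds _ _ _ _ cl Gp.
have [l2 [hl2 br]] := C1_up_to_bounds _ _ _ _ cr Gp.
have [rD rD0 DrD] : exists2 rD, 0 < rD & forall y t, `|y - x t0| < rD -> `|t - t0| < rD -> D (y, t).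
  have /nbhs_ballP[rD /= rD0 h] := open_nbhs_nbhs (conj oD Dp).
  by exists rD => // y t yx tt; apply: h; split; rewrite /ball /= distrC.
have E1 : l1 = um.
  apply: (@cvg_unique _ _ ((fun y => u (y, t0)) @ (x t0)^'-)) => //.
  apply/cvgrPdist_le => e e0; have [r [L [r_gt0 _ h]]] := bl e e0.
  near=> y.
  have ylt : y < x t0 by near: y; exact: nbhs_left_lt.
  have yr : `|y - x t0| < Num.min r rD.
    rewrite distrC gtr0_norm ?subr_gt0 // ltrBlDl -ltrBlDr.
    by near: y; apply: nbhs_left_gt; rewrite gtrBl lt_min r_gt0.
  move: yr; rewrite lt_min => /andP[yr yrD].
  rewrite distrC; apply: (h (y, t0) _ _ _).1; rewrite /= ?subrr ?normr0 //.
  by split => //=; apply: DrD; rewrite ?subrr ?normr0.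
have E2 : l2 = up.
  apply: (@cvg_unique _ _ ((fun y => u (y, t0)) @ (x t0)^'+)) => //.
  apply/cvgrPdist_le => e e0; have [r [L [r_gt0 _ h]]] := br e e0.
  near=> y.
  have ylt : x t0 < y by near: y; exact: nbhs_right_gt.
  have yr : `|y - x t0| < Num.min r rD.
    rewrite gtr0_norm ?subr_gt0 // ltrBlDl.
    by near: y; apply: nbhs_right_lt; rewrite ltrDl lt_min r_gt0.
  move: yr; rewrite lt_min => /andP[yr yrD].
  rewrite distrC; apply: (h (y, t0) _ _ _).1; rewrite /= ?subrr ?normr0 //.
  by split => //=; apply: DrD; rewrite ?subrr ?normr0.
exists um, up; split => // e e0.
have [r1 [L1 [r10 L10 h1]]] := bl e e0; have [r2 [L2 [r20 L20 h2]]] := br e e0.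
exists (Num.min rD (Num.min r1 r2)), (Num.max L1 L2).
have rP (z : R) : `|z| < Num.min rD (Num.min r1 r2) -> [/\ `|z| < rD, `|z| < r1 & `|z| < r2].
  by rewrite !lt_min => /and3P.
have timeI t : `|t - t0| < Num.min rD (Num.min r1 r2) -> 0 < t < T /\ I t.
  move=> /rP[trD _ _]; have /DT[_ /=] : D (x t0, t) by apply: DrD; rewrite ?subrr ?normr0.
  by rewrite in_itv /=.
split.
- by rewrite !lt_min rD0 r10.
- by rewrite le_max L10.
- by move=> t /timeI[].
split.
- by move=> t /timeI[].
- move=> t y /rP[tD t1 t2] /rP[yD y1 y2]; split => yx.
    by rewrite -E1; apply: (h1 (y, t) _ _ _).1 => //; split => //; exact: DrD.
  by rewrite -E2; apply: (h2 (y, t) _ _ _).1 => //; split => //; exact: DrD.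
move=> t y z tr yr zr yz side.
have [tD t1 t2] := rP _ tr.
have wr w : w \in `[y, z] -> `|w - x t0| < Num.min rD (Num.min r1 r2).
  by rewrite in_itv /=; exact: ball_between.
have [cL _ _ _] := cl; have [cR _ _ _] := cr.
apply: (derivative_bound_lipschitz (fun w => u (w, t)) (fun w => dx u (w, t))) => //.
  move=> w wyz; apply: slice_is_derive; have [wD _ _] := rP _ (wr w wyz).
  move: wyz; rewrite in_itv /= => /andP[yw wz].
  case: side => sd; [apply: cL|apply: cR]; split => //=; try exact: DrD.
    exact: le_lt_trans sd.
  exact: lt_le_trans yw.
move=> w wyz; have [wD w1 w2] := rP _ (wr w wyz).
move: wyz; rewrite in_itv /= => /andP[yw wz].
case: side => sd.
  rewrite (le_trans (h1 (w, t) _ _ _).2) ?le_max ?lexx //.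
  by split => //=; [exact: DrD|exact: le_lt_trans sd].
rewrite (le_trans (h2 (w, t) _ _ _).2) ?le_max ?lexx ?orbT //.
by split => //=; [exact: DrD|exact: lt_le_trans yw].
Unshelve. all: by end_near. Qed.

End NearTheJump.

(** * The discontinuity does not move *)

Section Stationarity.
Context {R : realType}.
Local Notation leb := (@lebesgue_measure R).

(** By the intermediate value theorem the curve takes its middle value; of the
    two resulting intervals, one has at most half the length, while both carry
    exactly half the displacement.  The mean speed never decreases. *)
Lemma bisection (x : R -> R) (s t : R) (n : nat) : s < t -> x s != x t ->
  {within `[s, t], continuous x} ->
  exists s', exists t', [/\ s <= s', s' < t', t' <= t,
    `|x t' - x s'| = `|x t - x s| / 2 ^+ n & t' - s' <= (t - s) / 2 ^+ n].
Proof.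
move=> st xst cx; elim: n => [|n [s' [t' [ss' s't' tt' xE tE]]]].
  by exists s, t; rewrite expr0 !divr1.
have cx' : {within `[s', t'], continuous x}.
  by apply: continuous_subspaceW cx; apply: subset_itv; rewrite bnd_simp.
pose c := (x s' + x t') / 2.
have hc : Num.min (x s') (x t') <= c <= Num.max (x s') (x t').
  by have [h|h] := ltP (x s') (x t'); rewrite /c; apply/andP; split; lra.
have [w] := IVT (ltW s't') cx' hc.
rewrite in_itv /= => /andP[s'w wt'] xw.
have pn : 0 < 2 ^+ n :> R by rewrite exprn_gt0.
have xN : 0 < `|x t - x s| by rewrite normr_gt0 subr_eq0 eq_sym.
have d0 : 0 < `|x t' - x s'| by rewrite xE divr_gt0.
have h1 : `|x w - x s'| = `|x t - x s| / 2 ^+ n.+1.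
  rewrite xw exprS invfM mulrCA -xE (_ : c - x s' = 2^-1 * (x t' - x s')); last by rewrite /c; field.
  by rewrite normrM ger0_norm // mulrC.
have h2 : `|x t' - x w| = `|x t - x s| / 2 ^+ n.+1.
  rewrite xw exprS invfM mulrCA -xE (_ : x t' - c = 2^-1 * (x t' - x s')); last by rewrite /c; field.
  by rewrite normrM ger0_norm // mulrC.
have pos : 0 < `|x t - x s| / 2 ^+ n.+1 by rewrite divr_gt0 // exprn_gt0.
have s'_w : s' < w.
  rewrite lt_neqAle s'w andbT; apply: contraTneq pos => e.
  by rewrite -h1 e subrr normr0 ltxx.
have w_t' : w < t'.
  rewrite lt_neqAle wt' andbT; apply: contraTneq pos => e.
  by rewrite -h2 e subrr normr0 ltxx.
have E : (t - s) / 2 ^+ n.+1 = (t - s) / 2 ^+ n / 2 by rewrite exprS invfM; ring.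
have [half|half] := leP (w - s') (t' - w).
  exists s', w; split => //; first exact: le_trans wt' tt'.
  by rewrite E; lra.
exists w, t'; split => //; first exact: le_trans ss' s'w.
by rewrite E; lra.
Qed.

Lemma plateau_mass (a b r : R) : 0 < r -> a + r <= b - r ->
  b - a - 2 * r <= \int[leb]_x plateau a b r x.
Proof.
move=> r0 ab.
have ii := integrable_indic_itv (a + r) (b - r) true false.
apply: le_trans (_ : \int[leb]_x \1_(`[a + r, b - r]) x <= _).
  by rewrite Rintegral_indic_itv // le_eqVlt; apply/orP; left; apply/eqP; ring.
apply: le_Rintegral => //; first exact: integrable_plateau.
move=> x _; have [xab|xab] := boolP (x \in `[a + r, b - r]).
  by rewrite plateau_in // indicE; case: (_ \in _).
by rewrite indicE memNset ?plateau_ge0 //; exact/negP.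
Qed.

Lemma continuous_near (x : R -> R) (t0 r c e : R) : `|c - t0| < r ->
  {for c, continuous x} -> 0 < e ->
  exists2 rho, 0 < rho & forall tau, `|tau - c| < rho ->
    `|tau - t0| < r /\ `|x tau - x c| < e.
Proof.
move=> cr cx e0; have /cvgrPdist_lt/(_ e e0)/nbhs_ballP[rho /= rho0 h] := cx.
exists (Num.min rho (r - `|c - t0|)); first by rewrite lt_min rho0 subr_gt0.
move=> tau; rewrite lt_min => /andP[t1 t2]; split.
  have := ler_distD c tau t0; lra.
by rewrite distrC; apply: h; rewrite /ball /= distrC.
Qed.

Lemma half_le_of_quarters (d p q r : R) : 0 < r -> d <= p + q -> p < r / 4 -> q < r / 4 ->
  d / 2 <= r.
Proof. by move=> ? ? ? ?; lra. Qed.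

(** The basic inequality on one window.  The plateau al is supported at distance
    at least d / 4 from x s and x t, where d is the displacement.  By continuity
    its support stays on one side of the curve shortly after s and on the other
    side shortly before t.  In between, the curve may cross the support in any
    way, since the bound on the nonlocal term is uniform in the position x tau. *)
Lemma jump_window (T delta : R) (omega : R -> R) (g : R -> R -> R)
    (u0 : R -> R) (u : R * R -> R) (N : set R) (x : R -> R)
    (C M L um up e r t0 s t eta : R) :
  nonlocal_kernel delta omega -> 0 <= C -> lipschitz_flux C g ->
  weak_solution T delta omega g u0 u ->
  measurable N -> leb N = 0%E -> 0 <= M ->
  (forall tau, ~ N tau -> tau \in `]0, T[ -> {ae leb, forall y, `|u (y, tau)| <= M}) ->
  0 < r -> 0 <= L -> jump_control T x u t0 um up e r L ->
  s < t -> `|s - t0| < r -> `|t - t0| < r -> x s != x t ->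
  {for s, continuous x} -> {for t, continuous x} ->
  `|x s - x t0| < r / 4 -> `|x t - x t0| < r / 4 -> 0 < eta <= r / 4 ->
  exists2 m, `|x t - x s| / 4 <= m &
  (`|um - up| - 2 * e) * m <=
   (t - s) * (2 * C * (L * r + 2 * M) * \int[leb]_(h in `[0, eta]) omega h + 4 * C * M / eta * m).
Proof.
move=> ker C0 gL weak mN N0 M0 uM r0 L0 [timeT sides lip] st sr tr xst cs ct xs xt /andP[eta0 etar].
pose d := `|x t - x s|.
have d0 : 0 < d by rewrite normr_gt0 subr_eq0 eq_sym.
pose a := Num.min (x s) (x t) + d / 4.
pose b := Num.max (x s) (x t) - d / 4.
have bE : b = a + d / 2.
  rewrite /a /b /d; case: ltgtP xst => // xst _.
    by rewrite gtr0_norm ?subr_gt0 //; field.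
  by rewrite ltr0_norm ?subr_lt0 //; field.
pose al := plateau a b (d / 8).
have d8 : 0 < d / 8 by rewrite divr_gt0.
have ab8 : a + d / 8 <= b - d / 8 by rewrite bE; lra.
have box y : y \in `[a - r / 4, b + r / 4] -> `|y - x t0| < r.
  move: xs xt; rewrite in_itv /= !ltr_norml /a /b => /andP[? ?] /andP[? ?].
  by have [h|h] := ltP (x s) (x t) => /andP[? ?]; apply/andP; split; lra.
have [A hA] := plateau_lipschitz a b (d / 8) d8.
pose m := \int[leb]_y al y.
have m_ge : d / 4 <= m.
  by apply: le_trans (plateau_mass _ _ _ d8 ab8); rewrite bE; lra.
exists m => //.
have [al0 al1] : (forall y, 0 <= al y) /\ (forall y, al y <= 1).
  by split => y; [exact: plateau_ge0|exact: plateau_le1].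
have al_out y : y \notin `[a, b] -> al y = 0 by exact: plateau_out.
have sal : smooth al by exact: smooth_plateau.
have /timeT/andP[s0 _] := sr; have /timeT/andP[_ tT] := tr.
have d4 : 0 < d / 4 by rewrite divr_gt0.
have [r1 r10 near_s] := continuous_near x t0 r s (d / 4) sr cs d4.
have [r2 r20 near_t] := continuous_near x t0 r t (d / 4) tr ct d4.
pose Theta := 2 * C * (L * r + 2 * M) * \int[leb]_(h in `[0, eta]) omega h + 4 * C * M / eta * m.
have abr y : y \in `[a, b] -> `|y - x t0| < r.
  rewrite in_itv /= => /andP[? ?]; apply: box; rewrite in_itv /=; apply/andP; split; lra.
have om0 : 0 <= \int[leb]_(h in `[0, eta]) omega h.
  by apply: Rintegral_ge0 => h _; exact: kernel_ge0 ker h.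
have Theta0 : 0 <= Theta.
  rewrite addr_ge0 // !mulr_ge0 // ?addr_ge0 ?mulr_ge0 ?invr_ge0 // ?ltW //.
  exact: lt_le_trans m_ge.
have nonloc tau k : ~ N tau -> tau \in `[s, t] -> 0 <= k <= 1 ->
     `|nonlocal_term delta omega g (fun y : R => u (y, tau)) (fun y : R => al y * k)| <= Theta.
  move=> Nt tst /andP[k0 k1].
  have [tau1 tau2] : s <= tau /\ tau <= t by move: tst; rewrite in_itv /= => /andP[].
  have taur : `|tau - t0| < r.
    by apply: (ball_between _ _ s t) => //; rewrite tau1.
  have tauT : tau \in `]0, T[ by rewrite in_itv /= timeT.
  have [_ [_ [mu _ _ _]]] := Lfun_oo_sections _ weak.1.
  have mk : \int[leb]_y (al y * k) = m * k by rewrite RintegralZr //; exact: integrable_plateau.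
  have dr : d / 2 <= r.
    have := ler_distD (x t0) (x t) (x s); rewrite -/d [`|x t0 - x s|]distrC => dd.
    by apply: half_le_of_quarters r0 dd xt xs.
  apply: le_trans (nonlocal_term_ae_le delta omega g C M L (A * k) eta a b (x tau)
    (fun y : R => u (y, tau)) (fun y => al y * k) ker C0 gL M0 _ _ _ _ _ _ _ L0 eta0 _) _.
  - exact: measurable_time_slice mu tauT.
  - exact: uM.
  - by move=> y; apply: cvgM; [exact: smooth_continuous|exact: cvg_cst].
  - by move=> y h; rewrite -mulrBl normrM (ger0_norm k0) mulrAC ler_wpM2r.
  - by move=> y; rewrite mulr_ge0 //= mulr_ile1.
  - by move=> y /al_out ->; rewrite mul0r.
  - by rewrite bE lerDl divr_ge0 // ltW.
  - move=> h y /andP[h0 heta]; rewrite in_itv /= => /andP[y1 y2] hy.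
    have := lip tau y (y + h) taur _ _ _ hy; rewrite (_ : y + h - y = h); last by ring.
    apply; last by rewrite lerDl ltW.
      apply: box; rewrite in_itv /= (le_trans _ y1) ?lerB //=; last exact: le_trans etar.
      by rewrite ler_wpDr // divr_ge0 // ltW.
    have yh : y <= y + h by rewrite lerDl ltW.
    apply: box; rewrite in_itv /= (le_trans _ (le_trans y1 yh)) ?lerB //=; last exact: le_trans etar.
    by rewrite lerD // (le_trans heta).
  rewrite mk /Theta lerD //.
    rewrite ler_wpM2r // ler_wpM2l ?mulr_ge0 // lerD2r ler_wpM2l //.
    by rewrite bE (_ : a + d / 2 - a = d / 2) //; ring.
  rewrite ler_wpM2l ?ler_piMr //.
    by rewrite !mulr_ge0 // invr_ge0 ltW.
  by apply: le_trans m_ge; rewrite ltW.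
have ns tau : tau \in `]s, s + Num.min r1 r2[ -> `|tau - t0| < r /\ `|x tau - x s| < d / 4.
  rewrite in_itv /= => /andP[? h]; apply: near_s; rewrite gtr0_norm ?subr_gt0 //.
  by rewrite ltrBlDl (lt_le_trans h) // lerD2l ge_min lexx.
have nt tau : tau \in `](t - Num.min r1 r2), t[ -> `|tau - t0| < r /\ `|x tau - x t| < d / 4.
  rewrite in_itv /= => /andP[h ?]; apply: near_t; rewrite ltr0_norm ?subr_lt0 //.
  rewrite opprB ltrBlDr -ltrBlDl (le_lt_trans _ h) // lerD2l lerN2 ge_min lexx orbT //.
have r12 : 0 < Num.min r1 r2 by rewrite lt_min r10.
(* The two directions of motion exchange the one-sided limits at times s and t. *)
have [PQ|PQ] : x s < x t \/ x t < x s by case: ltgtP xst => // ? _; [left|right].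
- have aE : a = x s + d / 4 by rewrite /a; case: ltP PQ => //; lra.
  have bE' : b = x t - d / 4 by rewrite /b; case: ltP PQ => //; lra.
  have := window_estimate T delta omega g u0 u N s t (Num.min r1 r2) a b up um e Theta al
     weak s0 st tT r12 sal al0 al_out _ _ mN N0 Theta0 nonloc.
  rewrite distrC; apply.
  + move=> tau y /ns[taur] /ltr_normlP[? ?] yab.
    apply: (sides tau y taur (abr y yab)).2; move: yab; rewrite in_itv /= => /andP[? ?]; lra.
  + move=> tau y /nt[taur] /ltr_normlP[? ?] yab.
    apply: (sides tau y taur (abr y yab)).1; move: yab; rewrite in_itv /= => /andP[? ?]; lra.
have aE : a = x t + d / 4 by rewrite /a; case: ltP PQ => //; lra.
have bE' : b = x s - d / 4 by rewrite /b; case: ltP PQ => //; lra.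
have := window_estimate T delta omega g u0 u N s t (Num.min r1 r2) a b um up e Theta al
    weak s0 st tT r12 sal al0 al_out _ _ mN N0 Theta0 nonloc.
apply.
+ move=> tau y /ns[taur] /ltr_normlP[? ?] yab.
  apply: (sides tau y taur (abr y yab)).1; move: yab; rewrite in_itv /= => /andP[? ?]; lra.
+ move=> tau y /nt[taur] /ltr_normlP[? ?] yab.
  apply: (sides tau y taur (abr y yab)).2; move: yab; rewrite in_itv /= => /andP[? ?]; lra.
Qed.

(** Absolute continuity of the integral of omega. *)
Lemma kernel_small_mass (delta : R) (omega : R -> R) (r eps : R) :
  nonlocal_kernel delta omega -> 0 < r -> 0 < eps ->
  exists2 eta, 0 < eta <= r & \int[leb]_(h in `[0, eta]) omega h <= eps.
Proof.
move=> ker r0 eps0.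
have iom : leb.-integrable `[0, 1] (EFin \o omega).
  by apply: (integrableS measurableT) => //; exact: kernel_integrable ker.
have := parameterized_integral_cvg_left ltr01 iom.
move=> /cvgrPdist_le/(_ eps eps0)/nbhs_ballP[e /= e0 h].
exists (Num.min (e / 2) r).
  by rewrite lt_min divr_gt0 //= r0 ge_min lexx orbT.
have := h (Num.min (e / 2) r); rewrite /ball /= !sub0r !normrN /parameterized_integral => H.
apply: le_trans (ler_norm _) _; apply: H.
rewrite ger0_norm; last by rewrite le_min divr_ge0 ?ltW.
by rewrite gt_min; apply/orP; left; lra.
Qed.

Lemma exists_pow2_gt (y : R) : exists n, y < 2 ^+ n.
Proof.
exists (Num.truncn y).+1; apply: lt_le_trans (truncnS_gt y) _.
by rewrite -natrX ler_nat ltnW // ltn_expl.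
Qed.

Lemma interior_continuous (I : set R) (x : R -> R) (t : R) :
  {within I, continuous x} -> I° t -> {for t, continuous x}.
Proof.
move=> cx It.
have : {within I°, continuous x} by apply: continuous_subspaceW cx; exact: interior_subset.
by rewrite continuous_open_subspace; [apply; rewrite inE|exact: open_interior].
Qed.

(** The two contributions to the nonlocal term are each at most m J / 8, whereas
    the jump contributes m J / 2. *)
Lemma window_absurd (J K B kap om m len : R) : 0 < J -> 0 < m -> 0 <= K -> 0 <= om ->
  len <= kap * (4 * m) -> kap * 4 * K * om <= J / 8 -> len * B <= J / 8 ->
  (J - 2 * (J / 4)) * m <= len * (K * om + B * m) -> False.
Proof.
move=> J0 m0 K0 om0 len_le om_small B_small main.
have c1 := ler_wpM2r (mulr_ge0 K0 om0) len_le.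
have c2 := ler_wpM2l (ltW m0) om_small.
have c3 := ler_wpM2l (ltW m0) B_small.
have c4 := mulr_gt0 m0 J0.
by lra.
Qed.

(** kap is the inverse of the mean speed between s and t.  The window given by
    bisection has length at most kap times its displacement, and m is at least a
    quarter of that displacement; eta is chosen in terms of kap, and only then
    the number n of bisections in terms of eta. *)
Lemma locally_constant (T delta : R) (omega : R -> R) (g : R -> R -> R)
    (u0 : R -> R) (u : R * R -> R) (I : set R) (x : R -> R) (C t0 : R) :
  nonlocal_kernel delta omega -> 0 <= C -> lipschitz_flux C g ->
  weak_solution T delta omega g u0 u ->
  piecewise_C1_with_jump T I x u -> I° t0 ->
  exists2 rho, 0 < rho & forall s t, `|s - t0| < rho -> `|t - t0| < rho -> x s = x t.
Proof.
move=> ker C0 gL weak jump It0.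
have [um [up [umup near_jump]]] := jump_control_exists _ _ _ _ _ jump It0.
pose J := `|um - up|.
have J0 : 0 < J by rewrite normr_gt0 subr_eq0.
have [r [L [r0 L0 timeI control]]] := near_jump (J / 4) (divr_gt0 J0 (ltr0n _ 4)).
have [M0 [N [_ mN N0 uM0]]] := Lfun_oo_sections _ weak.1.
pose M := Num.max M0 0.
have M_ge0 : 0 <= M by rewrite le_max lexx orbT.
have uM tau : ~ N tau -> tau \in `]0, T[ -> {ae leb, forall y, `|u (y, tau)| <= M}.
  move=> /uM0[N' [mN' N'0 sub]] tauT; exists N'; split => // y /= hy; apply: sub => /= h.
  by apply: hy; move: h; rewrite patchE mem_set //= le_max => ->.
have cx t : `|t - t0| < r -> {for t, continuous x}.
  move=> tr; apply: interior_continuous jump.1 _.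
  apply/nbhs_ballP; exists (r - `|t - t0|); first by rewrite /= subr_gt0.
  move=> y; rewrite /ball /= => ty; apply: timeI.
  by have := ler_distD t y t0; rewrite [`|y - t|]distrC; lra.
have t0r : `|t0 - t0| < r by rewrite subrr normr0.
have [rho rho0 near0] := continuous_near x t0 r t0 (r / 4) t0r (cx _ t0r) (divr_gt0 r0 (ltr0n _ 4)).
exists rho => //.
suff H s t : s < t -> `|s - t0| < rho -> `|t - t0| < rho -> x s = x t.
  by move=> s t sr tr; case: (ltgtP s t) => [?|?|-> //]; [exact: H|apply/esym; exact: H].
move=> st srho trho; apply: contrapT => /eqP xst.
have D0 : 0 < `|x t - x s| by rewrite normr_gt0 subr_eq0 eq_sym.
have [kap kap0 kapE] : exists2 kap, 0 < kap & t - s = kap * `|x t - x s|.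
  exists ((t - s) / `|x t - x s|); first by rewrite divr_gt0 // subr_gt0.
  by rewrite divfK // gt_eqF.
pose K := 2 * C * (L * r + 2 * M).
have K0 : 0 <= K by rewrite !mulr_ge0 // addr_ge0 // mulr_ge0 // ltW.
have K1 : 0 < K + 1 by rewrite ltr_wpDl.
(* With this bound on the mass of omega, 4 kap K eps <= J / 8. *)
have eps0 : 0 < J / (32 * kap * (K + 1)).
  by rewrite divr_gt0 // !mulr_gt0.
have [eta eta01 om_eta] := kernel_small_mass _ _ _ _ ker (divr_gt0 r0 (ltr0n _ 4)) eps0.
have /andP[eta0 _] := eta01.
pose B := 4 * C * M / eta.
have B0 : 0 <= B by rewrite divr_ge0 ?(ltW eta0) // !mulr_ge0.
have [n hn] := exists_pow2_gt ((t - s) * B * 8 / J).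
have between w : s <= w <= t -> `|w - t0| < rho.
  exact: ball_between.
have cst : {within `[s, t], continuous x}.
  apply: continuous_in_subspaceT => w; rewrite inE /= in_itv /= => wst.
  by apply: cx; have [] := near0 w (between w wst).
have [s' [t' [ss' s't' t't xE tE]]] := bisection x s t n st xst cst.
have [s'r xs'] := near0 s' (between s' (introT andP (conj ss' (ltW (lt_le_trans s't' t't))))).
have [t'r xt'] := near0 t' (between t' (introT andP (conj (ltW (le_lt_trans ss' s't')) t't))).
have pn : 0 < 2 ^+ n :> R by rewrite exprn_gt0.
have xst' : x s' != x t'.
  by rewrite eq_sym -subr_eq0 -normr_gt0 xE divr_gt0.
have [m m_ge] := jump_window T delta omega g u0 u N x C M L um up (J / 4) r t0 s' t' eta
  ker C0 gL weak mN N0 M_ge0 uM r0 L0 control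
  s't' s'r t'r xst' (cx _ s'r) (cx _ t'r) xs' xt' eta01.
rewrite -/J -/K -/B.
set om := \int[leb]_(h in _) omega h => main.
have om0 : 0 <= om by apply: Rintegral_ge0 => h _; exact: kernel_ge0 ker h.
have m0 : 0 < m by apply: lt_le_trans m_ge; rewrite xE !divr_gt0.
have st'0 : 0 <= t' - s' by rewrite subr_ge0 ltW.
have b1 : t' - s' <= kap * (4 * m).
  apply: le_trans tE _.
  have -> : (t - s) / 2 ^+ n = kap * (`|x t - x s| / 2 ^+ n).
    by rewrite kapE mulrA.
  by rewrite ler_wpM2l ?(ltW kap0) // -xE; lra.
have b2 : kap * 4 * K * om <= J / 8.
  apply: (@le_trans _ _ (kap * 4 * (K + 1) * (J / (32 * kap * (K + 1))))).
    have k4 : 0 <= kap * 4 by rewrite mulr_ge0 // ltW.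
    by apply: ler_pM => //; [exact: mulr_ge0|rewrite ler_wpM2l // lerDl].
  by rewrite le_eqVlt; apply/orP; left; apply/eqP; field; rewrite !gt_eqF.
have b3 : (t' - s') * B <= J / 8.
  apply: (@le_trans _ _ ((t - s) / 2 ^+ n * B)); first by rewrite ler_wpM2r.
  rewrite mulrAC ler_pdivrMr //.
  by rewrite mulrAC ler_pdivlMr // -[leRHS]mulrC -ler_pdivrMr // ltW.
exact: (window_absurd J K B kap om m (t' - s')).
Qed.

End Stationarity.

Theorem theorem2p4 (R : realType) (T delta : R) (hT : 0 < T) (hdelta : 0 < delta)
    (omega : R -> R) (homega : nonlocal_kernel delta omega)
    (f : R -> R) (g : R -> R -> R) (hg : numerical_flux f g)
    (u0 : R -> R) (hu0 : u0 \in Lfun (@lebesgue_measure R) +oo%E)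
    (u : R * R -> R) (hu : weak_solution T delta omega g u0 u)
    (I : set R) (hI : is_interval I) (hIT : I `<=` `[0, T[)
    (x : R -> R) (hrect : rectifiable I (fun t => (x t, t)))
    (hjump : piecewise_C1_with_jump T I x u) :
  (forall t, interior I t -> is_derive t 1 x 0) /\
  (forall s t, I s -> I t -> x s = x t).
Proof.
have [C0 gL0] := flux_lipschitz hg.
have gL : lipschitz_flux (Num.max C0 0) g.
  move=> a b a' b'; apply: le_trans (gL0 _ _ _ _) _.
  by rewrite ler_wpM2r ?addr_ge0 // le_max lexx.
have C_ge0 : 0 <= Num.max C0 0 by rewrite le_max lexx orbT.
have der t : I° t -> is_derive t 1 x 0.
  move=> It; have [rho rho0 hrho] :=
    locally_constant _ _ _ _ _ _ _ _ _ _ homega C_ge0 gL hu hjump It.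
  apply: (@near_eq_is_derive _ _ _ (cst (x t))).
  apply/nbhs_ballP; exists rho => //= y; rewrite /ball /= => ty.
  by apply: hrho; rewrite ?subrr ?normr0 // distrC.
split => //.
suff H s t : s < t -> I s -> I t -> x s = x t.
  by move=> s t Is It; case: (ltgtP s t) => [?|?|-> //]; [exact: H|apply/esym; exact: H].
move=> st Is It.
have cx : {within `[s, t], continuous x}.
  apply: continuous_subspaceW hjump.1 => w /=; rewrite in_itv /=; exact: hI.
have der_in w : w \in `]s, t[ -> is_derive w 1 x 0.
  move=> wst; apply: der; apply: filterS (near_in_itvoo wst) => y.
  by rewrite in_itv /= => /andP[sy yt]; apply: (hI s t) => //; rewrite !ltW.
have [c _] := @MVT_segment R x (cst 0) s t (ltW st) der_in cx.
by rewrite mul0r => /eqP; rewrite subr_eq0 => /eqP.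
Qed.
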